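(* For every $g\geq 0$, the closure operation $\chi$ is a bijection from $\mathcal{O}_g$ to $\mathcal{BC}_g$ preserving the degree distribution of vertices; its restriction to 4-valent maps is a bijection from $\mathcal{O}^\times_g$ to $\mathcal{BC}^\times_g$. Moreover, for every $\mathfrak{o}\in\mathcal{O}_g$, the closure induces a bijection between the white leaves of $\mathfrak{o}$ and the white faces of $\chi(\mathfrak{o})$, and a bijection between the black leaves of $\mathfrak{o}$ and the black faces of $\chi(\mathfrak{o})$ other than the root face. Consequently $O_g(z_\bullet,z_\circ;d_1,d_2,\ldots;t)=BC_g(z_\bullet,z_\circ;d_1,d_2,\ldots;t)$ and $O^\times_g(z_\bullet,z_\circ)=BC^\times_g(z_\bullet,z_\circ)$.
   Context: A map of genus $g$ is a cellular embedding of a connected finite graph (loops and multiple edges allowed) in the compact orientable surface of genus $g$, up to orientation-preserving homeomorphism, determined by the counterclockwise cyclic order of half-edges at vertices; a corner is a pair of consecutive half-edges at a vertex; a rooted map has a marked root corner, lying in the root face. A map is bicolorable if its faces can be colored black and white so that every edge separates faces of different colors; rooted bicolorable maps are always colored with black root face. $\mathcal{BC}_g$ is the set of rooted bicolorable maps of genus $g$, $\mathcal{BC}^\times_g$ those that are 4-valent (all vertices of degree 4), and $BC_g=\sum_{\mathfrak{m}\in\mathcal{BC}_g}t^{|E(\mathfrak{m})|}z_\bullet^{|F_\bullet(\mathfrak{m})|}z_\circ^{|F_\circ(\mathfrak{m})|}\prod_{i\geq1}d_i^{n_i(\mathfrak{m})}$, where $F_\bullet,F_\circ$ are the black and white faces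 and $n_i$ the number of vertices of degree $2i$; $BC^\times_g(z_\bullet,z_\circ)=\sum_{\mathfrak{m}\in\mathcal{BC}^\times_g}z_\bullet^{|F_\bullet(\mathfrak{m})|}z_\circ^{|F_\circ(\mathfrak{m})|}$. A blossoming map is a map with extra dangling half-edges (stems) inserted in the cyclic orders at vertices; a stem is a leaf if oriented towards its vertex, a bud otherwise. Degrees count edges and stems; the interior map consists of the ordinary edges. A rooted blossoming map has a marked bud (root bud); its root corner is the corner immediately preceding the root bud counterclockwise. For a rooted unicellular (one-face) blossoming map, the clockwise contour is the cyclic sequence of corners and stems met along the face boundary from the root corner, with the face on the right. Canonical labeling: root corner $0$; the next corner in the contour keeps the label across an edge traversal, gains $1$ across a bud, loses $1$ across a leaf; a stem between corners labelled $i-1$ and $i$ has label $i$; a leaf is black if its label is even and white if odd. Well-oriented: every interior edge is oriented opposite to its first traversal by the contour. Well-labeled: corners on the same side of an edge have equal labels, and consecutive corners around a vertex differ by $1$ with the larger on the left of the separating edge or stem. Well-rooted: as many leaves as buds and all canonical labels nonnegative. $\mathcal{O}_g$ is the set of well-rooted, well-labeled, well-oriented rooted unicellular blossoming maps of genus $g$ and $\mathcal{O}^\times_g$ its 4-valent elements; $O_g=\sum_{\mathfrak{o}\in\mathcal{O}_g}t^{|E(\mathfrak{o})|}z_\bullet^{\ell_\bullet(\mathfrak{o})+1}z_\circ^{\ell_\circ(\mathfrak{o})}\prod_i d_i^{n_i(\mathfrak{o})}$ (with $E(\mathfrak{o})$ the interior edges, $\ell_\bullet,\ell_\circ$ the numbers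 of black and white leaves, $n_i$ the number of vertices of degree $2i$), and $O^\times_g=\sum_{\mathfrak{o}\in\mathcal{O}^\times_g}z_\bullet^{\ell_\bullet(\mathfrak{o})+1}z_\circ^{\ell_\circ(\mathfrak{o})}$. Closure $\chi(\mathfrak{o})$: order the stems cyclically by the contour; repeatedly merge a bud whose next stem is a leaf with that leaf into an edge oriented from the bud's vertex to the leaf's vertex, removing both from the order, until no stems remain; root the result at the corner that preceded the root bud.
   Formalization: In O_g the exponent of t counts the interior edges plus the leaves (i.e. the edges of the closure), not the interior edges alone; with interior edges only, O_0 = BC_0 already fails for the planar loop with one vertex. *)

(* Defs.v *)
From HB Require Import structures.
From mathcomp Require Import all_boot all_order all_fingroup all_algebra.
From mathcomp Require Import zify finmap.
From mathcomp Require Import boolp classical_sets functions cardinality.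
From mathcomp Require Import fintype finset.

Set Implicit Arguments.
Unset Strict Implicit.
Unset Printing Implicit Defensive.

Import Order.TTheory GRing.Theory Num.Theory.

(* Combinatorial maps on a set D of half-edges (darts).  vrot sends a half-edge
   to the next one counterclockwise around its vertex; einv exchanges the two
   halves of an edge, and its fixed points are the stems (dangling half-edges).
   A dart h also stands for the corner immediately preceding h
   counterclockwise, i.e. the corner between vrot^-1 h and h; the root corner is
   the corner of the dart rootd.  The map with one vertex and no half-edge has no
   corner to be rooted at. *)
Record premap (D : finType) :=
  PreMap { vrot : {perm D}; einv : {perm D}; rootd : D }.

(* out is the set of half-edges oriented away from their vertex: for a stem,
   h \in out means that h is a bud, and h \notin out that h is a leaf. *)
Record blossoming (D : finType) :=
  Blossoming { underlying :> premap D; out : {set D} }.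

Section FinTypes.
Variable D : finType.

Definition premap_repr (m : premap D) := (vrot m, einv m, rootd m).
Definition premap_abs (x : {perm D} * {perm D} * D) :=
  PreMap x.1.1 x.1.2 x.2.
Lemma premap_reprK : cancel premap_repr premap_abs. Proof. by case. Qed.
HB.instance Definition _ := Finite.copy (premap D) (can_type premap_reprK).

Definition blossoming_repr (o : blossoming D) := (underlying o, out o).
Definition blossoming_abs (x : premap D * {set D}) := Blossoming x.1 x.2.
Lemma blossoming_reprK : cancel blossoming_repr blossoming_abs.
Proof. by case. Qed.
HB.instance Definition _ :=
  Finite.copy (blossoming D) (can_type blossoming_reprK).

End FinTypes.

Section Maps.
Variable D : finType.
Implicit Types (m : premap D) (h : D).

Definition vertices m : {set {set D}} := porbits (vrot m).

Definition edges m : {set {set D}} := [set e in porbits (einv m) | #|e| == 2].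

Definition stems m : {set D} := [set h | einv m h == h].

(* One step of the clockwise contour (face on the right), from the corner of h:
   across the edge containing h if there is one, past the stem h otherwise.
   Permutations compose from left to right: face_perm m h = vrot (einv h). *)
Definition face_perm m : {perm D} := (einv m * vrot m)%g.

(* The face containing the corner of h; when h is half of an edge, this is the
   face to the right of that edge followed from h to einv m h. *)
Definition face m h : {set D} := porbit (face_perm m) h.

Definition faces m : {set {set D}} := porbits (face_perm m).

Definition connected m : bool :=
  [forall x, forall y,
     connect [rel x y | (y == vrot m x) || (y == einv m x)] x y].

(* Euler's formula V - E + F = 2 - 2g. *)
Definition genus_is (g : nat) m : bool :=
  #|vertices m| + #|faces m| + g.*2 == #|edges m| + 2.

Definition degree_count (d : nat) m : nat := #|[set v in vertices m | #|v| == d]|.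

Definition four_valent m : bool := [forall v in vertices m, #|v| == 4].

Definition is_rooted_map m : bool :=
  [&& [forall h, einv m (einv m h) == h], stems m == set0 & connected m].

(* A coloring of the faces is given by its set B of black faces. *)
Definition bicoloring m (B : {set {set D}}) : bool :=
  (B \subset faces m) &&
  [forall h, (face m h \in B) != (face m (einv m h) \in B)].

Definition bicolorable m : bool := [exists B, bicoloring m B].

Definition black_faces m : {set {set D}} :=
  odflt set0 [pick B | bicoloring m B && (face m (rootd m) \in B)].

Definition white_faces m : {set {set D}} := faces m :\: black_faces m.

Definition is_BC (g : nat) m : bool :=
  [&& is_rooted_map m, genus_is g m & bicolorable m].

Definition rename (s : {perm D}) m : premap D :=
  PreMap (vrot m ^ s)%g (einv m ^ s)%g (s (rootd m)).

Definition map_class m : {set premap D} := [set rename s m | s : {perm D}].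

End Maps.

Section Blossoming.
Variable D : finType.
Implicit Types (o : blossoming D) (h : D).

Definition buds o : {set D} := stems o :&: out o.

Definition leaves o : {set D} := stems o :\: out o.

Definition is_rooted_blossoming o : bool :=
  [&& [forall h, einv o (einv o h) == h],
      [forall h, (einv o h != h) ==> ((einv o h \in out o) != (h \in out o))],
      connected o & rootd o \in buds o].

Definition unicellular o : bool := #|faces o| == 1.

Definition contour o : seq D := fingraph.orbit (face_perm o) (rootd o).

Definition contour_step o h : int :=
  if h \in buds o then 1%R else if h \in leaves o then (-1)%R else 0%R.

(* The canonical label of the corner of h. *)
Definition label o h : int :=
  (\sum_(x <- take (index h (contour o)) (contour o)) contour_step o x)%R.

(* A stem h lies between the corners of h and of vrot h. *)
Definition stem_label o h : int := Num.max (label o h) (label o (vrot o h)).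

Definition black_leaves o : {set D} :=
  [set h in leaves o | (2 %| stem_label o h)%Z].

Definition white_leaves o : {set D} := leaves o :\: black_leaves o.

(* If the contour first traverses an edge from h to einv o h, then the edge is
   oriented towards the vertex of h. *)
Definition well_oriented o : bool :=
  [forall h, (einv o h != h) &&
     (index h (contour o) < index (einv o h) (contour o)) ==> (h \notin out o)].

(* The corners of h and of face_perm o h lie on the same side of the edge of h;
   the corners of h and of vrot o h are separated by h, the latter being on the
   left of h when h leaves its vertex and on its right otherwise. *)
Definition well_labeled o : bool :=
  [forall h, (einv o h != h) ==> (label o (face_perm o h) == label o h)] &&
  [forall h, if h \in out o then label o (vrot o h) == (label o h + 1)%R
             else label o h == (label o (vrot o h) + 1)%R].

Definition well_rooted o : bool :=
  (#|leaves o| == #|buds o|) && [forall h, (0 <= label o h)%R].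

Definition is_O (g : nat) o : bool :=
  [&& is_rooted_blossoming o, unicellular o, genus_is g o,
      well_rooted o, well_labeled o & well_oriented o].

(* A state of the closure is the cyclic sequence of the remaining stems and the
   current pairing of half-edges.  The bud merged first does not matter; we take
   the first one in the contour whose next stem is a leaf. *)
Definition merge_step o (st : seq D * {perm D}) : seq D * {perm D} :=
  let: (s, a) := st in
  if [seq b <- s | (b \in out o) && (next s b \notin out o)] is b :: _ then
    let l := next s b in
    ([seq x <- s | (x != b) && (x != l)], (a * tperm b l)%g)
  else st.

Definition closed_einv o : {perm D} :=
  (iter #|stems o| (merge_step o)
     ([seq h <- contour o | h \in stems o], einv o)).2.

(* The corner preceding the root bud is still the corner of the dart rootd o. *)
Definition close_map o : premap D := PreMap (vrot o) (closed_einv o) (rootd o).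

Definition brename (s : {perm D}) o : blossoming D :=
  Blossoming (rename s o) (s @: out o).

Definition blossoming_class o : {set blossoming D} :=
  [set brename s o | s : {perm D}].

End Blossoming.

(* Maps up to isomorphism: equivalence classes, under renaming of the
   half-edges, of maps whose half-edges are the elements of some 'I_n. *)
Definition map_iso := {n : nat & {set premap 'I_n}}.
Definition blossoming_iso := {n : nat & {set blossoming 'I_n}}.

Definition map_classes (P : forall n, premap 'I_n -> Prop) : set map_iso :=
  [set c | exists n (m : premap 'I_n),
     P n m /\ c = Tagged (fun n => {set premap 'I_n}) (map_class m)]%classic.

Definition blossoming_classes (P : forall n, blossoming 'I_n -> Prop) :
    set blossoming_iso :=
  [set c | exists n (o : blossoming 'I_n),
     P n o /\
     c = Tagged (fun n => {set blossoming 'I_n}) (blossoming_class o)]%classic.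

Definition calBC (g : nat) : set map_iso := map_classes (fun n m => is_BC g m).

Definition calBC4 (g : nat) : set map_iso :=
  map_classes (fun n m => is_BC g m && four_valent m).

Definition calO (g : nat) : set blossoming_iso :=
  blossoming_classes (fun n o => is_O g o).

Definition calO4 (g : nat) : set blossoming_iso :=
  blossoming_classes (fun n o => is_O g o && four_valent o).

Definition chi (c : blossoming_iso) : map_iso :=
  Tagged (fun n => {set premap 'I_n}) (@close_map _ @: tagged c).

(* The monomial t^exp_t zb^exp_zb zw^exp_zw prod_(i >= 1) d_i^(exp_d i.-1). *)
Record monomial :=
  Monomial { exp_t : nat; exp_zb : nat; exp_zw : nat; exp_d : nat -> nat }.

(* A formal power series is the function giving its coefficients. *)
Definition series := monomial -> nat.

(* Exponents of zb and zw. *)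
Definition series2 := nat * nat -> nat.

Definition map_weight (D : finType) (m : premap D) : monomial :=
  Monomial #|edges m| #|black_faces m| #|white_faces m|
    (fun i => degree_count i.+1.*2 m).

(* The exponent of t counts the interior edges together with one edge for each
   pair formed by a bud and a leaf, i.e. the edges of the closure. *)
Definition blossoming_weight (D : finType) (o : blossoming D) : monomial :=
  Monomial (#|edges o| + #|leaves o|) #|black_leaves o|.+1 #|white_leaves o|
    (fun i => degree_count i.+1.*2 o).

(* fset_set A is empty when A is infinite; the sets counted below are finite, by
   the lemmas finite_BC_coef, ..., finite_O4_coef. *)
Definition card_classes (T : choiceType) (A : set T) : nat := #|` fset_set A|.

Definition BC_coef (g : nat) (x : monomial) : set map_iso :=
  map_classes (fun n m => is_BC g m /\ map_weight m = x).

Definition O_coef (g : nat) (x : monomial) : set blossoming_iso :=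
  blossoming_classes (fun n o => is_O g o /\ blossoming_weight o = x).

Definition BC4_coef (g : nat) (x : nat * nat) : set map_iso :=
  map_classes (fun n m => is_BC g m && four_valent m /\
    (#|black_faces m|, #|white_faces m|) = x).

Definition O4_coef (g : nat) (x : nat * nat) : set blossoming_iso :=
  blossoming_classes (fun n o => is_O g o && four_valent o /\
    (#|black_leaves o|.+1, #|white_leaves o|) = x).

Definition BC_series (g : nat) : series := fun x => card_classes (BC_coef g x).
Definition O_series (g : nat) : series := fun x => card_classes (O_coef g x).
Definition BC4_series (g : nat) : series2 := fun x => card_classes (BC4_coef g x).
Definition O4_series (g : nat) : series2 := fun x => card_classes (O4_coef g x).

Lemma finite_map_classes (N : nat) (P : forall n, premap 'I_n -> Prop) :
  (forall n (m : premap 'I_n), P n m -> n <= N) -> finite_set (map_classes P).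
Proof.
move=> leN.
pose f (x : {i : 'I_N.+1 & {set premap 'I_i}}) : map_iso :=
  Tagged (fun n => {set premap 'I_n}) (tagged x).
apply: (@sub_finite_set _ _ (f @` [set: _])%classic).
  move=> _ [n [m [Pm ->]]]; have ltn : n < N.+1 by apply: leN Pm.
  by exists (Tagged (fun i : 'I_N.+1 => {set premap 'I_i})
               (map_class m : {set premap 'I_(Ordinal ltn)})).
by apply: finite_image; apply: finite_finset.
Qed.

Lemma finite_blossoming_classes (N : nat)
    (P : forall n, blossoming 'I_n -> Prop) :
  (forall n (o : blossoming 'I_n), P n o -> n <= N) ->
  finite_set (blossoming_classes P).
Proof.
move=> leN.
pose f (x : {i : 'I_N.+1 & {set blossoming 'I_i}}) : blossoming_iso :=
  Tagged (fun n => {set blossoming 'I_n}) (tagged x).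
apply: (@sub_finite_set _ _ (f @` [set: _])%classic).
  move=> _ [n [o [Po ->]]]; have ltn : n < N.+1 by apply: leN Po.
  by exists (Tagged (fun i : 'I_N.+1 => {set blossoming 'I_i})
               (blossoming_class o : {set blossoming 'I_(Ordinal ltn)})).
by apply: finite_image; apply: finite_finset.
Qed.

Section Cardinals.
Variable D : finType.
Implicit Types (m : premap D) (o : blossoming D).

Lemma sum_card_porbits (s : {perm D}) : \sum_(A in porbits s) #|A| = #|D|.
Proof.
rewrite -[RHS]cardsT; apply/esym/card_partition/and3P; split.
- apply/eqP/setP => x; rewrite !inE; apply/bigcupP.
  by exists (porbit s x); [apply: imset_f | apply: porbit_id].
- apply/trivIsetP => _ _ /imsetP[x _ ->] /imsetP[y _ ->] neq.
  rewrite -setI_eq0; apply/eqP/setP => z; rewrite !inE; apply/negbTE.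
  apply: contra neq => /andP[]; rewrite -!eq_porbit_mem => /eqP zx /eqP zy.
  by rewrite -zx zy.
- by apply/imsetP => -[x _ x0]; have := porbit_id s x; rewrite -x0 inE.
Qed.

Lemma card_darts m :
  (forall h, einv m (einv m h) = h) -> #|D| <= 2 * #|edges m| + #|stems m|.
Proof.
move=> invK.
have sub : [set: D] \subset cover (edges m) :|: stems m.
  apply/subsetP => h _; rewrite inE [h \in stems m]inE orbC.
  case: eqVneq => //= neq; apply/bigcupP; exists (porbit (einv m) h).
    rewrite inE imset_f //=; have -> : porbit (einv m) h = [set h; einv m h].
      apply/setP => x; rewrite !inE; apply/porbitP/orP.
        move=> [i ->]; elim: i => [|i [/eqP|/eqP] IH]; first by left; rewrite perm1.
          by right; rewrite expgSr permM IH.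
        by left; rewrite expgSr permM IH invK.
      by case=> /eqP ->; [exists 0; rewrite perm1 | exists 1%N; rewrite expg1].
    by rewrite cards2 [h == _]eq_sym neq.
  exact: porbit_id.
rewrite -cardsT; apply: leq_trans (subset_leq_card sub) _.
apply: leq_trans (leq_card_setU _ _) _; rewrite leq_add2r.
apply: leq_trans (leq_card_cover _) _; rewrite mulnC -sum_nat_const.
by apply: leq_sum => A; rewrite inE => /andP[_ /eqP ->].
Qed.

Lemma card_darts4 m : four_valent m -> #|D| = #|vertices m| * 4.
Proof.
move=> /forall_inP m4; rewrite -(sum_card_porbits (vrot m)) -sum_nat_const.
by apply: eq_bigr => A /m4/eqP.
Qed.

Lemma card_darts_BC g m : is_BC g m -> #|D| <= 2 * #|edges m|.
Proof.
case/and3P=> /and3P[/forallP invK /eqP st0 _] _ _.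
have := card_darts (fun h => eqP (invK h)).
by rewrite st0 cards0 addn0.
Qed.

Lemma card_darts_O g o : is_O g o -> #|D| <= 2 * (#|edges o| + #|leaves o|).
Proof.
case/and4P=> /and4P[/forallP invK _ _ _] _ _ /and3P[/andP[/eqP eq_lb _] _ _].
have := card_darts (fun h => eqP (invK h)).
by rewrite -(cardsID (out o) (stems o)) -/(buds o) -/(leaves o) -eq_lb; lia.
Qed.

Lemma card_black_white_faces m :
  #|faces m| <= #|black_faces m| + #|white_faces m|.
Proof.
by rewrite -(cardsID (black_faces m) (faces m)) leq_add2r subset_leq_card ?subsetIr.
Qed.

Lemma card_black_white_leaves o :
  #|leaves o| <= #|black_leaves o| + #|white_leaves o|.
Proof.
by rewrite -(cardsID (black_leaves o) (leaves o)) leq_add2r subset_leq_card ?subsetIr.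
Qed.

Lemma genus_leq g m : genus_is g m ->
  #|edges m| + 2 = #|vertices m| + #|faces m| + g.*2.
Proof. by move/eqP. Qed.

End Cardinals.

Lemma finite_BC_coef g x : finite_set (BC_coef g x).
Proof.
apply: (@finite_map_classes (2 * exp_t x)) => n m [/card_darts_BC].
by rewrite card_ord => ? <-.
Qed.

Lemma finite_O_coef g x : finite_set (O_coef g x).
Proof.
apply: (@finite_blossoming_classes (2 * exp_t x)) => n o [/card_darts_O].
by rewrite card_ord => ? <-.
Qed.

Lemma finite_BC4_coef g x : finite_set (BC4_coef g x).
Proof.
apply: (@finite_map_classes (4 * (x.1 + x.2 + g.*2))) => n m [/andP[BCm m4] <-].
have := card_darts_BC BCm; have := card_darts4 m4; rewrite card_ord /=.
have := card_black_white_faces m.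
case/and3P: BCm => _ /genus_leq + _.
by move: #|edges m| #|vertices m| #|faces m| #|black_faces m| #|white_faces m|; lia.
Qed.

Lemma finite_O4_coef g x : finite_set (O4_coef g x).
Proof.
apply: (@finite_blossoming_classes (4 * (x.1 + x.2 + g.*2))) => n o [/andP[Oo o4] <-].
have := card_darts_O Oo; have := card_darts4 o4; rewrite card_ord /=.
have := card_black_white_leaves o.
case/and4P: Oo => _ /eqP F1 /genus_leq + _; rewrite F1.
by move: #|edges o| #|vertices o| #|leaves o| #|black_leaves o| #|white_leaves o|; lia.
Qed.

(* Main.v *)
(* A bicolorable map is labelled by the dual distance of its faces to the root
   face, and every edge is oriented with the larger label on its left.  For a
   blossoming map o, the canonical labels of the corners are constant on the
   faces of its closure, and the non-root face of label i closed by a leaf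
   lies, in the contour, between that leaf and its bud, at height i; hence each
   non-root face contains exactly one leaf, through which its label decreases,
   and the canonical labels are the dual distances of the closure.

   Conversely the labels, hence the orientation, are determined by the closure,
   and an edge is interior exactly when it is first reached by the contour
   against its orientation.  So the contour is determined step by step, which
   gives injectivity, and following this rule in a map gives surjectivity.
   The exploration returns to the root with as many visited leaves as visited
   buds, so that cut edges are seen on both sides; the set of visited corners is
   then a union of faces, and by induction on the dual distance it contains all
   of them.  Finally each cut edge leads from a bud to a later leaf of the same
   label, and the parenthesis matching is the only such pairing. *)

Require Import Defs.
From mathcomp Require Import all_boot all_order all_fingroup all_algebra.
From mathcomp Require Import zify finmap.
From mathcomp Require Import boolp classical_sets functions cardinality.
From mathcomp Require Import fintype finset.

Set Implicit Arguments.
Unset Strict Implicit.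
Unset Printing Implicit Defensive.

Import Order.TTheory GRing.Theory Num.Theory.

(** * Orbits of permutations and of involutions *)

Section Permutations.
Variable D : finType.
Implicit Types (p : {perm D}) (x y : D).

Lemma porbit_ind p (P : D -> Prop) x :
  P x -> (forall y, P y -> P (p y)) -> forall y, y \in porbit p x -> P y.
Proof.
move=> Px Pp _ /porbitP[i ->]; elim: i => [|i IH]; first by rewrite perm1.
by rewrite expgSr permM; apply: Pp.
Qed.

Lemma porbit_step p x : porbit p (p x) = porbit p x.
Proof. by have := porbit_perm p 1 x; rewrite expg1. Qed.

Lemma mem_porbit_step p x : p x \in porbit p x.
Proof. by rewrite -eq_porbit_mem porbit_step. Qed.

Lemma porbit_invariant (T : Type) p (f : D -> T) :
  (forall x, f (p x) = f x) -> forall x y, porbit p x = porbit p y -> f x = f y.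
Proof.
move=> fp x y /eqP; rewrite eq_porbit_mem.
by apply: (porbit_ind (P := fun z => f z = f y)) => // z <-.
Qed.

Lemma mem_fingraph_orbit p x y : (y \in fingraph.orbit p x) = (y \in porbit p x).
Proof.
rewrite -fconnect_orbit; apply/idP/porbitP => [/iter_findex <-|[i ->]].
  by exists (findex p x y); rewrite permX.
by rewrite permX fconnect_iter.
Qed.

(** An orbit of an involution is either a pair, which is an edge, or a singleton, which is a
    stem. *)
Lemma involution_edges_card (m : premap D) :
  (forall h, einv m (einv m h) = h) -> #|D| = 2 * #|edges m| + #|stems m|.
Proof.
move=> invK.
have orbE x : porbit (einv m) x = [set x; einv m x].
  apply/setP => y; rewrite !inE; apply/idP/orP.
    apply: (porbit_ind (P := fun y => (y == x) \/ (y == einv m x)))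
      => [|z [/eqP->|/eqP->]]; first by left.
      by right.
    by left; rewrite invK.
  by case=> /eqP->; rewrite ?porbit_id ?mem_porbit_step.
have cardE x : #|porbit (einv m) x| = (einv m x != x).+1.
  by rewrite orbE cards2 eq_sym.
rewrite -(sum_card_porbits (einv m)) (bigID (fun A : {set D} => #|A| == 2)) /=.
congr (_ + _).
  rewrite mulnC -sum_nat_const; apply: eq_big => A; first by rewrite inE.
  by case/andP=> _ /eqP.
transitivity (\sum_(A in [set [set x] | x in stems m]) 1).
  apply: eq_big => [A|A /andP[/imsetP[x _ ->]]]; last first.
    by rewrite cardE; case: (einv m x == x).
  apply/andP/imsetP => [[/imsetP[x _ ->]]|[x]].
    rewrite cardE => neq2.
    have xs : einv m x = x by apply/eqP; move: neq2; case: (einv m x == x).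
    by exists x; rewrite ?inE ?xs // orbE xs setUid.
  rewrite inE => /eqP xs ->; split; last by rewrite cards1.
  by apply/imsetP; exists x => //; rewrite orbE xs setUid.
by rewrite sum1_card card_imset //; apply: set1_inj.
Qed.

End Permutations.

(** * The contour of a unicellular map as a linear order on its darts *)

Section Contour.
Variables (D : finType) (o : blossoming D).
Hypothesis uni : unicellular o.
Local Notation idx h := (index h (contour o)).

Lemma unicellular_porbit h : h \in porbit (face_perm o) (rootd o).
Proof.
case/cards1P: uni => F FE.
have inF x : porbit (face_perm o) x = F.
  by apply/set1P; rewrite -FE; apply: imset_f.
by rewrite -eq_porbit_mem !inF.
Qed.

Lemma mem_contour h : h \in contour o.
Proof. by rewrite mem_fingraph_orbit unicellular_porbit. Qed.

Lemma contour_uniq : uniq (contour o).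
Proof. exact: orbit_uniq. Qed.

Lemma idx_inj x y : idx x = idx y -> x = y.
Proof. by move/(congr1 (nth x (contour o))); rewrite !nth_index ?mem_contour. Qed.

Lemma idx_lt_size h : idx h < size (contour o).
Proof. by rewrite index_mem mem_contour. Qed.

Lemma idx_root : idx (rootd o) = 0.
Proof. exact: findex0. Qed.

Lemma iter_idx h : iter (idx h) (face_perm o) (rootd o) = h.
Proof. by apply: iter_findex; rewrite fconnect_orbit mem_contour. Qed.

Lemma idx_face h :
  face_perm o h <> rootd o -> idx (face_perm o h) = (idx h).+1.
Proof.
rewrite -{1 2}(iter_idx h) -iterS => neq.
rewrite [LHS](_ : _ = findex (face_perm o) (rootd o)
  (iter (idx h).+1 (face_perm o) (rootd o))) //.
have := idx_lt_size h; rewrite size_orbit leq_eqVlt => /orP[/eqP E|?].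
  by case: neq; rewrite E iter_order //; apply: perm_inj.
by rewrite findex_iter.
Qed.

(** The later dart [y] shows that [x] is not the last dart of the contour, so the step from [x] does
    not wrap around to the root. *)
Lemma idx_face_lt x y : idx x < idx y -> idx (face_perm o x) = (idx x).+1.
Proof.
move=> lt; apply: idx_face => E.
have := idx_lt_size y; rewrite ltnNge => /negP; apply.
have: fingraph.order (face_perm o) (rootd o) <= idx x + 1.
  rewrite leqNgt; apply/negP => lt'.
  have := findex_iter lt'.
  by rewrite addn1 iterS iter_idx E findex0.
by rewrite size_orbit; lia.
Qed.

Lemma idx_pred h : h <> rootd o ->
  exists2 p, h = face_perm o p & idx h = (idx p).+1.
Proof.
move=> neq; exists ((face_perm o)^-1 h)%g; first by rewrite permKV.
by rewrite -idx_face ?permKV.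
Qed.

Lemma unicellular_connected :
  connected o.
Proof.
apply/forallP => x; apply/forallP => y.
have: y \in porbit (face_perm o) x.
  by rewrite -eq_porbit_mem;
    have /eqP <- : porbit (face_perm o) (rootd o) == porbit (face_perm o) y;
    rewrite eq_sym eq_porbit_mem unicellular_porbit.
apply: (porbit_ind (P := fun y => connect
  [rel x y | (y == vrot o x) || (y == einv o x)] x y)) => // z /connect_trans; apply.
apply: (@connect_trans _ _ (einv o z)); apply: connect1 => /=.
  by rewrite eqxx orbT.
by rewrite permM eqxx.
Qed.

End Contour.

(** * Parenthesis matching of buds and leaves *)

Section Matching.
Variables (D : finType) (o : blossoming D).
Local Notation idx h := (index h (contour o)).
Implicit Types (b l h x y z : D) (s : seq D) (a : {perm D}).

(** [l] is the first leaf after [b] past which the label is back to that of [b]. This expresses the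
    parenthesis matching by labels alone, independently of the order of the mergings. *)
Definition matched b l : bool :=
  [&& b \in buds o, l \in leaves o, idx b < idx l,
      label o l == (label o b + 1)%R &
      [forall x, (idx b < idx x <= idx l) ==> (label o b < label o x)%R]].

(** These are the conditions of [is_O] other than the genus, which is compared separately by Euler's
    formula. *)
Definition opening : bool :=
  [&& is_rooted_blossoming o, unicellular o, well_rooted o, well_labeled o
    & well_oriented o].

Hypothesis Oo : opening.

Lemma opening_unicellular : unicellular o. Proof. by case/and5P: Oo. Qed.
Let uni := opening_unicellular.

Lemma opening_einvK h : einv o (einv o h) = h.
Proof. by case/and5P: Oo => /and4P[/forallP/(_ h)/eqP]. Qed.

Lemma opening_interior_out h : einv o h != h -> (einv o h \in out o) = (h \notin out o).
Proof.
case/and5P: Oo => /and4P[_ /forallP/(_ h)/implyP H _ _] _ _ _ _ /H.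
by do 2!case: (_ \in out o).
Qed.

Lemma opening_rootd_bud : rootd o \in buds o.
Proof. by case/and5P: Oo => /and4P[]. Qed.

Lemma label_ge0 h : (0 <= label o h)%R.
Proof. by case/and5P: Oo => _ _ /andP[_ /forallP]. Qed.

Lemma label_vrot h :
  label o (vrot o h) = (label o h + if h \in out o then 1 else -1)%R.
Proof.
case/and5P: Oo => _ _ _ /andP[_ /forallP/(_ h)] + _.
by case: ifP => _ /eqP ->; lia.
Qed.

Lemma label_face_interior h :
  einv o h != h -> label o (face_perm o h) = label o h.
Proof.
by case/and5P: Oo => _ _ _ /andP[/forallP/(_ h)/implyP H _] _ /H/eqP.
Qed.

Lemma budP b : reflect (einv o b = b /\ b \in out o) (b \in buds o).
Proof. by rewrite !inE; apply: (iffP andP) => -[/eqP]. Qed.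

Lemma leafP l : reflect (einv o l = l /\ l \notin out o) (l \in leaves o).
Proof. by rewrite !inE andbC; apply: (iffP andP) => -[/eqP]. Qed.

Lemma contour_step_stem h : h \in stems o ->
  contour_step o h = (if h \in out o then 1 else -1)%R.
Proof. by rewrite /contour_step !inE => /eqP ->; rewrite eqxx /=; case: (h \in out o). Qed.

Lemma contour_step_bud b : b \in buds o -> contour_step o b = 1%R.
Proof. by rewrite /contour_step => ->. Qed.

Lemma contour_step_leaf l : l \in leaves o -> contour_step o l = (-1)%R.
Proof. by case/leafP => ll lo; rewrite contour_step_stem ?inE ?ll // (negbTE lo). Qed.

Lemma contour_step_interior h : h \notin stems o -> contour_step o h = 0%R.
Proof. by rewrite /contour_step !inE => /negbTE ->; rewrite andbF. Qed.

Lemma face_stem h : h \in stems o -> face_perm o h = vrot o h.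
Proof. by rewrite inE permM => /eqP ->. Qed.

(** This also covers the last step of the contour, back to the root, because it is derived from the
    well-labeling and not from the partial sums defining [label]. *)
Lemma label_face h : label o (face_perm o h) = (label o h + contour_step o h)%R.
Proof.
have [st|] := boolP (h \in stems o).
  by rewrite face_stem // label_vrot contour_step_stem.
move=> ne; rewrite contour_step_interior // addr0 label_face_interior //.
by rewrite inE in ne.
Qed.

Lemma label_face_leaf l : l \in leaves o -> label o (face_perm o l) = (label o l - 1)%R.
Proof. by move=> bb; rewrite label_face contour_step_leaf. Qed.

Lemma label_rootd : label o (rootd o) = 0%R.
Proof. by rewrite /label idx_root take0 big_nil. Qed.

(** For the set of all stems this is the canonical label; for the stems remaining during the
    closure, it is the label that they alone would produce. *)
Definition height (S : pred D) z : int :=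
  (\sum_(x | S x && (idx x < idx z)%N) contour_step o x)%R.

Lemma label_height z : label o z = height [in stems o] z.
Proof.
have [n] := ubnP (idx z); elim: n z => // n IH z zn.
have [->|/eqP neq] := eqVneq z (rootd o).
  by rewrite label_rootd /height big1 // => x; rewrite idx_root ltn0 andbF.
have [p zE idxz] := idx_pred uni neq.
rewrite zE label_face IH; last by lia.
rewrite /height -zE idxz big_mkcond [RHS]big_mkcond /=.
rewrite [RHS](bigD1 p) // [X in (X + _)%R](bigD1 p) //= ltnn ltnSn andbF andbT add0r addrC.
congr (_ + _)%R.
  apply: eq_bigr => x neqx; rewrite ltnS.
  have /negbTE ne : idx x != idx p.
    by apply: contraNneq neqx => E; rewrite (idx_inj uni E).
  by rewrite (leq_eqVlt (idx x)) ne.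
by have [_|/contour_step_interior] := boolP (p \in stems o).
Qed.

(* Merging an adjacent bud and leaf lowers the height of the remaining stems only
   between them, so heights stay below the labels and remain exact on s; this
   is what makes the labels between a merged bud and leaf exceed that of the
   bud. *)
Record merging_invariant (s : seq D) (a : {perm D}) : Prop := MergingInvariant {
  merging_sorted : sorted (relpre (fun x => idx x) ltn) s;
  merging_stems : {subset s <= stems o};
  merging_sum : (\sum_(x in s) contour_step o x)%R = 0%R;
  merging_height_le : forall z, (height [in s] z <= label o z)%R;
  merging_height_eq : forall z, z \in s -> height [in s] z = label o z;
  merging_fixed : {in s, forall x, a x = x};
  merging_interior : forall x, einv o x != x -> a x = einv o x;
  merging_bud : forall b, b \in buds o -> b \notin s -> matched b (a b);
  merging_leaf : forall l, l \in leaves o -> l \notin s -> matched (a l) l;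
  merging_notin : forall x, x \notin s -> a x \notin s
}.

Lemma mem_buds_leaves x : x \in stems o -> (x \in buds o) || (x \in leaves o).
Proof. by rewrite !inE => ->; case: (_ \in _). Qed.

Lemma merging_invariant_init :
  merging_invariant [seq h <- contour o | h \in stems o] (einv o).
Proof.
set s := [seq _ <- _ | _].
have memsE x : (x \in s) = (x \in stems o) by rewrite mem_filter mem_contour ?andbT.
have heightE z : height [in s] z = label o z.
  by rewrite label_height; apply: eq_bigl => x /=; rewrite !inE memsE inE.
split=> //.
- apply: sorted_filter; first by move=> x y z /=; apply: ltn_trans.
  apply/(sortedP (rootd o)) => i lti /=.
  by rewrite !index_uniq ?contour_uniq // ltnW.
- by move=> x; rewrite memsE.
- case/and5P: Oo => _ _ /andP[/eqP eq_lb _] _ _.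
  rewrite (bigID (fun x => x \in out o)) /=.
  rewrite [X in (X + _)%R](eq_big (fun x => x \in buds o) (fun=> 1%R)); first last.
  - by move=> x /andP[]; rewrite memsE => xs xo; rewrite contour_step_stem ?xo.
  - by move=> x; rewrite inE memsE.
  rewrite [X in (_ + X)%R](eq_big (fun x => x \in leaves o) (fun=> (-1)%R)); first last.
  - by move=> x /andP[]; rewrite memsE => xs xo; rewrite contour_step_stem ?(negbTE xo).
  - by move=> x; rewrite inE memsE andbC.
  by rewrite !sumr_const eq_lb mulNrn subrr.
- by move=> z; rewrite heightE.
- by move=> x; rewrite memsE inE => /eqP.
- by move=> b; rewrite memsE !inE => /andP[->].
- by move=> b; rewrite memsE !inE => /andP[_ ->].
- by move=> x; rewrite !memsE !inE opening_einvK eq_sym.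
Qed.

Lemma sorted_pairwise_idx s : sorted (relpre (fun x => idx x) ltn) s ->
  pairwise (relpre (fun x => idx x) ltn) s.
Proof. by rewrite sorted_pairwise // => x y z /=; apply: ltn_trans. Qed.

Lemma sorted_uniq_idx s : sorted (relpre (fun x => idx x) ltn) s -> uniq s.
Proof.
by apply: sorted_uniq => [x y z /=|x /=]; [apply: ltn_trans | rewrite ltnn].
Qed.

(** The first remaining stem has height 0, hence label 0; if it were a leaf, the label past it would
    be -1. *)
Lemma merging_head_out x s a : merging_invariant (x :: s) a -> x \in out o.
Proof.
move=> inv; apply/negPn/negP => xo.
have := merging_height_eq inv (mem_head x s); rewrite /height big1 => [lx|z].
  have := label_ge0 (vrot o x); rewrite label_vrot -lx (negbTE xo).
  by rewrite add0r oppr_ge0 ler10.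
have /andP[/allP lt _] := sorted_pairwise_idx (merging_sorted inv).
rewrite inE => /andP[/orP[/eqP->|/lt /= lt'] lt'']; first by rewrite ltnn in lt''.
by have := ltn_trans lt' lt''; rewrite ltnn.
Qed.

(** The steps of the remaining stems sum to 0; if the last one were a bud, those before it would sum
    to -1, which would be its label. *)
Lemma merging_last_out x s a :
  merging_invariant (x :: s) a -> last x s \notin out o.
Proof.
move=> inv; set y := last x s; apply/negP => yo.
have ys : y \in x :: s by apply: mem_last.
have := label_ge0 y; rewrite -(merging_height_eq inv ys) /height.
have := merging_sum inv; rewrite (bigD1 y) //= contour_step_stem ?(merging_stems inv) // yo.
rewrite (eq_bigl (fun z => (z \in x :: s) && (idx z < idx y)%N)) => [|z]; last first.
  case: (boolP (z \in x :: s)) => //= zs.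
  have := sorted_pairwise_idx (merging_sorted inv).
  rewrite lastI -cats1 pairwise_cat => /and3P[lt _ _].
  move: zs; rewrite lastI -cats1 mem_cat inE => /orP[zs|/eqP ->]; last by rewrite eqxx ltnn.
  have := allrelP lt z y zs (mem_head _ _); rewrite /= => ltzy; rewrite ltzy.
  by apply: contraTneq ltzy => ->; rewrite ltnn.
move=> /eqP; rewrite addrC addr_eq0 => /eqP sumE ge0.
by have : (0 <= - 1 :> int)%R by rewrite -sumE.
Qed.

Lemma next_cat (s1 s2 : seq D) b l :
  uniq (s1 ++ b :: l :: s2) -> next (s1 ++ b :: l :: s2) b = l.
Proof.
move=> us; rewrite next_nth mem_cat mem_head orbT.
have bs1 : b \notin s1.
  by move: us; rewrite cat_uniq /= negb_or => /and3P[_ /andP[]].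
case: s1 bs1 us => [|x s1] /=; first by rewrite eqxx.
rewrite inE negb_or eq_sym => /andP[/negbTE -> bs1] _.
by rewrite index_cat (negbTE bs1) /= eqxx addn0 nth_cat ltnNge leqnSn subSnn.
Qed.

(** If no bud were followed by a leaf, being a bud would propagate from the first remaining stem to
    the last one, which is a leaf. *)
Lemma merging_next_out s a : merging_invariant s a -> s != [::] ->
  has (fun b => (b \in out o) && (next s b \notin out o)) s.
Proof.
case: s => // x s inv _; rewrite -[has _ _]negbK -all_predC.
apply/negP => /allP noadj.
have us := sorted_uniq_idx (merging_sorted inv).
have: path.cycle [rel x y | (x \in out o) ==> (y \in out o)] (x :: s).
  apply: cycle_from_next => // z /noadj /=.
  by rewrite negb_and negbK implybE.
rewrite /= rcons_path => /andP[px _].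
have := merging_last_out inv; rewrite -[_ \notin _]/(_ _).
have trans : transitive [rel x y | (x \in out o) ==> (y \in out o)].
  by move=> u v w /= /implyP uv /implyP vw; apply/implyP => /uv.
have := order_path_min trans px.
have := mem_last x s; rewrite inE => /orP[/eqP ->|lxs /allP/(_ _ lxs)/=].
  by rewrite (merging_head_out inv).
by rewrite (merging_head_out inv) /= => ->.
Qed.

Lemma merge_step_invariant s a : merging_invariant s a -> s != [::] ->
  merging_invariant (merge_step o (s, a)).1 (merge_step o (s, a)).2 /\
  size (merge_step o (s, a)).1 < size s.
Proof.
move=> inv s0; have := merging_next_out inv s0.
rewrite has_filter /merge_step; case E: [seq b <- s | _] => [//|b t] _ /=.
have: b \in [seq b <- s | (b \in out o) && (next s b \notin out o)] by rewrite E mem_head.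
rewrite mem_filter => /andP[/andP[bo]]; set l := next s b => lo bs.
have us := sorted_uniq_idx (merging_sorted inv).
(* The cyclic successor [l] of [b] is also its successor in the list: [b] is not the last stem,
   since the last one is a leaf. *)
have [s1 [s2 sE]] : exists s1 s2, s = s1 ++ b :: l :: s2.
  move: bo lo; rewrite /l; case/splitPr: bs us inv => s1 [|l' s2] us inv bo.
    case: s1 us inv => [|x s1] us inv; first by rewrite /= eqxx bo.
    by have := merging_last_out inv; rewrite last_cat /= bo.
  by rewrite next_cat // => _; exists s1, s2.
have ls : l \in s by rewrite sE mem_cat !inE eqxx !orbT.
have bb : b \in buds o by rewrite inE bo (merging_stems inv).
have ll : l \in leaves o by rewrite inE lo (merging_stems inv).
have pw := sorted_pairwise_idx (merging_sorted inv).
have [ltbl split_s] : idx b < idx l /\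
    (forall x, x \in s -> x != b -> x != l -> idx x < idx b \/ idx l < idx x).
  move: pw; rewrite sE pairwise_cat => /and3P[/allrelP lt1 _].
  rewrite pairwise_cons => /andP[/allP ltb]; rewrite pairwise_cons => /andP[/allP ltl _].
  split; first by apply: (ltb l); rewrite mem_head.
  move=> x; rewrite mem_cat !inE => /orP[xs1 _ _|/or3P[->//|->//|xs2 _ _]].
    by left; apply: lt1; rewrite // mem_head.
  by right; apply: ltl.
have neqbl : b != l by apply: contraTneq ltbl => ->; rewrite ltnn.
have memE x : (x \in [seq x <- s | (x != b) && (x != l)]) = [&& x \in s, x != b & x != l].
  by rewrite mem_filter andbC.
have heightE z : height [in s] z =
    (height [in [seq x <- s | (x != b) && (x != l)]] z
     + (idx b < idx z)%N%:R - (idx l < idx z)%N%:R)%R.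
  rewrite /height big_mkcondr (bigD1 b) //= (bigD1 l) /=; last by rewrite ls eq_sym.
  rewrite contour_step_bud // contour_step_leaf // addrA addrC.
  rewrite -big_mkcondr -addrA; congr (_ + _)%R.
    by apply: eq_bigl => x; rewrite memE -!andbA.
  by do 2!case: ifP.
have heightb : height [in s] b = label o b := merging_height_eq inv bs.
have heightl : height [in s] l = label o l := merging_height_eq inv ls.
have no_between x : x \in s -> idx b < idx x -> idx x < idx l -> False.
  move=> xs bx xl; have [] // := split_s x xs.
  - by apply: contraTneq bx => ->; rewrite ltnn.
  - by apply: contraTneq xl => ->; rewrite ltnn.
  - by move/(ltn_trans bx); rewrite ltnn.
  - by move/(ltn_trans xl); rewrite ltnn.
(* No remaining stem lies strictly between [b] and [l], so the height there stays one above that of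
   [b]; as heights bound labels from below, this yields [matched b l]. *)
have height_in z : idx b < idx z <= idx l -> height [in s] z = (label o b + 1)%R.
  move=> /andP[bz zl]; rewrite -heightb /height [RHS]addrC.
  rewrite (bigD1 b) /= ?bs ?bz // contour_step_bud //; congr (_ + _)%R.
  apply: eq_bigl => x; case: (boolP (x \in s)) => //= xs.
  have [->|neq] := eqVneq x b; first by rewrite ltnn andbF.
  rewrite andbT; apply/idP/idP => [xz|xb]; last exact: ltn_trans bz.
  have : idx x != idx b by apply: contraNneq neq => /(idx_inj uni) ->.
  case: ltngtP => // bx _; case: (no_between x) => //.
  exact: leq_trans zl.
have mbl : matched b l.
  apply/and5P; split=> //.
    by rewrite -heightl height_in // ltbl leqnn.
  apply/forallP => x; apply/implyP => bx.
  have := merging_height_le inv x; by rewrite height_in // lezD1.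
have tpE x : x != b -> x != l -> tperm b l x = x.
  by move=> xb xl; rewrite tpermD // eq_sym.
have a_out x : x \notin s -> (a * tperm b l)%g x = a x.
  move=> /(merging_notin inv) nin; rewrite permM tpE //.
    by apply: contraNneq nin => ->.
  by apply: contraNneq nin => ->.
have ab : (a * tperm b l)%g b = l by rewrite permM (merging_fixed inv bs) tpermL.
have al : (a * tperm b l)%g l = b by rewrite permM (merging_fixed inv ls) tpermR.
split; last first.
  have : size (filter (predC (fun x => (x != b) && (x != l))) s) > 0.
    rewrite size_filter -has_count; apply/hasP; exists b => //=.
    by rewrite eqxx.
  rewrite !size_filter -[X in _ -> _ < X](count_predC (fun x => (x != b) && (x != l)) s).
  by rewrite -[X in _ -> X < _]addn0 ltn_add2l.
split.
- apply: sorted_filter; first by move=> x y z /=; apply: ltn_trans.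
  exact: merging_sorted inv.
- by move=> x; rewrite memE => /andP[/(merging_stems inv)].
- have := merging_sum inv; rewrite (bigD1 b) //= (bigD1 l) /=; last by rewrite ls eq_sym.
  rewrite contour_step_bud // contour_step_leaf // addrA subrr add0r => H.
  by rewrite -[RHS]H; apply: eq_bigl => x; rewrite memE -andbA.
- move=> z; have := merging_height_le inv z; rewrite heightE.
  apply: le_trans; rewrite -addrA lerDl subr_ge0 ler_nat.
  by case: (ltnP (idx l) (idx z)) => // lz; rewrite (ltn_trans ltbl lz).
- move=> z; rewrite memE => /and3P[zs zb zl]; rewrite -(merging_height_eq inv zs) heightE.
  case: (split_s z zs zb zl) => [zb'|lz].
    by rewrite [idx b < _]ltnNge [idx l < _]ltnNge (ltnW zb') (ltnW (ltn_trans zb' ltbl)) addr0 subr0.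
  by rewrite lz (ltn_trans ltbl lz) addrK.
- move=> x; rewrite memE => /and3P[xs xb xl].
  by rewrite permM (merging_fixed inv xs) tpE.
- move=> x xi; rewrite a_out ?(merging_interior inv) //.
  by apply: contra xi => /(merging_stems inv); rewrite inE.
- move=> x xb; rewrite memE; have [->|neqb] := eqVneq x b; first by rewrite ab.
  have [E'|neql] := eqVneq x l; first by case/budP: xb; rewrite E' (negbTE lo).
  by rewrite !andbT => xs; rewrite a_out // (merging_bud inv).
- move=> x xb; rewrite memE; have [E'|neqb] := eqVneq x b.
    by case/leafP: xb; rewrite E' bo.
  have [->|neql] := eqVneq x l; first by rewrite al.
  by rewrite !andbT => xs; rewrite a_out // (merging_leaf inv).
- move=> x; rewrite !memE; have [->|neqb] := eqVneq x b.
    by rewrite ab !eqxx !andbF.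
  have [->|neql] := eqVneq x l; first by rewrite al !eqxx /= !andbF.
  by rewrite !andbT => xs; rewrite a_out // (negbTE (merging_notin inv xs)).
Qed.

(** Each merging shortens the list of stems, so [#|stems o|] iterations empty it; on the empty list
    [merge_step] does nothing. *)
Lemma closed_invariant : exists2 a, merging_invariant [::] a & closed_einv o = a.
Proof.
rewrite /closed_einv; set st := (_, einv o).
have: size st.1 <= #|stems o|.
  rewrite /= cardE -(size_map id) map_id; apply: uniq_leq_size.
    by rewrite filter_uniq ?contour_uniq.
  by move=> x; rewrite mem_filter mem_enum => /andP[].
have: merging_invariant st.1 st.2 by apply: merging_invariant_init.
move: #|stems o| st; elim=> [|n IH] [s a] /= inv.
  by rewrite leqn0 size_eq0 => /eqP s0; rewrite s0 in inv; exists a.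
have [s0|s0] := eqVneq s [::].
  move=> _; rewrite -iterS iterSr s0 /=; apply: IH => //.
  by rewrite -s0.
move=> lt; rewrite -iterS iterSr.
have [inv' lt'] := merge_step_invariant inv s0.
by apply: IH => //; rewrite -ltnS; apply: leq_trans lt' lt.
Qed.

End Matching.

(** * Faces, colors and genus of the closure *)

Section Closure.
Variables (D : finType) (o : blossoming D).
Hypothesis Oo : opening o.
Local Notation idx h := (index h (contour o)).
Local Notation mu := (closed_einv o).
Local Notation m := (close_map o).
Implicit Types b l h x y z : D.
Let uni := opening_unicellular Oo.

Lemma matched_between b l x : matched o b l -> idx b < idx x -> idx x <= idx l ->
  (label o b < label o x)%R.
Proof. by case/and5P=> _ _ _ _ /forallP/(_ x)/implyP H bx xl; apply: H; rewrite bx. Qed.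

(** If [l] came before [l'], the corner following [l], whose label is that of [b], would lie between
    [b] and [l'], where labels are larger. *)
Lemma matched_leaf_inj b l l' : matched o b l -> matched o b l' -> l = l'.
Proof.
wlog lt : l l' / idx l < idx l'.
  move=> H ml ml'; case: (ltngtP (idx l) (idx l')) => [lt|lt|/(idx_inj uni) //].
    exact: H.
  exact/esym/H.
case/and5P=> _ ll bl /eqP lab _ ml'.
have := matched_between ml' (x := face_perm o l); rewrite (idx_face_lt uni lt).
rewrite label_face_leaf // lab addrK ltxx => H.
by have := H (leqW bl) lt.
Qed.

(** Both buds have the label of [l] minus one, yet the later one lies between the earlier one and
    [l], where labels are larger. *)
Lemma matched_bud_inj b b' l : matched o b l -> matched o b' l -> b = b'.
Proof.
wlog lt : b b' / idx b < idx b'.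
  move=> H mb mb'; case: (ltngtP (idx b) (idx b')) => [lt|lt|/(idx_inj uni) //].
    exact: H.
  exact/esym/H.
move=> mb /and5P[_ _ bl /eqP lab _].
have := matched_between mb lt (ltnW bl).
by case/and5P: mb => _ _ _ /eqP; rewrite lab => /addIr ->; rewrite ltxx.
Qed.

Lemma closed_interior h : einv o h != h -> mu h = einv o h.
Proof. by have [a inv ->] := closed_invariant Oo; apply: merging_interior inv h. Qed.

Lemma closed_bud b : b \in buds o -> matched o b (mu b).
Proof. by have [a inv ->] := closed_invariant Oo => bb; apply: (merging_bud inv). Qed.

Lemma closed_leaf l : l \in leaves o -> matched o (mu l) l.
Proof. by have [a inv ->] := closed_invariant Oo => ll; apply: (merging_leaf inv). Qed.

Lemma matched_bud b l : matched o b l -> b \in buds o.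
Proof. by case/and5P. Qed.

Lemma matched_leaf b l : matched o b l -> l \in leaves o.
Proof. by case/and5P. Qed.

Lemma matched_lt b l : matched o b l -> idx b < idx l.
Proof. by case/and5P. Qed.

Lemma matched_label b l : matched o b l -> label o l = (label o b + 1)%R.
Proof. by case/and5P=> _ _ _ /eqP. Qed.

Variant dart_spec h : Prop :=
  | InteriorDart of einv o h != h
  | BudDart of h \in buds o
  | LeafDart of h \in leaves o.

Lemma dartP h : dart_spec h.
Proof.
have [st|] := boolP (h \in stems o).
  by case/orP: (mem_buds_leaves st); [apply: BudDart | apply: LeafDart].
by rewrite inE; apply: InteriorDart.
Qed.

Lemma closedK h : mu (mu h) = h.
Proof.
have [int|bb|ll] := dartP h.
- by rewrite !closed_interior ?(opening_einvK Oo) // eq_sym.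
- have mb := closed_bud bb.
  exact: matched_bud_inj (closed_leaf (matched_leaf mb)) mb.
- have ml := closed_leaf ll.
  exact: matched_leaf_inj (closed_bud (matched_bud ml)) ml.
Qed.

Lemma closed_neq h : mu h != h.
Proof.
have [int|/closed_bud/matched_lt|/closed_leaf/matched_lt] := dartP h.
- by rewrite closed_interior.
- by apply: contraTneq => ->; rewrite ltnn.
- by apply: contraTneq => ->; rewrite ltnn.
Qed.

Lemma face_perm_close h : face_perm m h = vrot o (mu h).
Proof. by rewrite permM. Qed.

(** Along a merged edge the label changes by one from one end to the other, and turning past the far
    end undoes this change. *)
Lemma label_face_close h : label o (face_perm m h) = label o h.
Proof.
rewrite face_perm_close; have [int|bb|ll] := dartP h.
- by rewrite closed_interior // -permM label_face_interior.
- have mb := closed_bud bb; rewrite label_vrot //.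
  have /leafP[_ /negbTE ->] := matched_leaf mb.
  by rewrite (matched_label mb) addrK.
- have ml := closed_leaf ll; rewrite label_vrot //.
  have /budP[_ ->] := matched_bud ml.
  by rewrite (matched_label ml).
Qed.

Lemma label_closed h : label o (mu h) = label o (vrot o h).
Proof. by rewrite -[in RHS](closedK h) -face_perm_close label_face_close. Qed.

Lemma label_same_face x y : face m x = face m y -> label o x = label o y.
Proof. exact/porbit_invariant/label_face_close. Qed.

(** The corners between [mu l] and [l] with the label of [l] are stable under the face permutation:
    an interior step advances by one, a bud skips to the corner past its leaf, and a leaf at this
    label can only be [l], from which one jumps back to the corner past [mu l]. *)
Lemma face_close_leaf l x : l \in leaves o -> x \in face m l ->
  [/\ idx (mu l) < idx x, idx x <= idx l & label o x = label o l].
Proof.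
move=> ll; have ml := closed_leaf ll; set b := mu l in ml *.
apply: (porbit_ind (P := fun x =>
  [/\ idx b < idx x, idx x <= idx l & label o x = label o l])).
  by split=> //; apply: matched_lt ml.
move=> {}x [bx xl lab]; rewrite label_face_close lab.
suff [? ?] : idx b < idx (face_perm m x) /\ idx (face_perm m x) <= idx l by [].
have [int|bb|lx] := dartP x.
- have lt : idx x < idx l.
    rewrite ltn_neqAle xl andbT; apply: contraNneq int => /(idx_inj uni) ->.
    by case/leafP: ll => ->.
  have -> : face_perm m x = face_perm o x by rewrite face_perm_close closed_interior // permM.
  by rewrite (idx_face_lt uni lt) lt ltnW.
- have mx := closed_bud bb; set l' := mu x in mx.
  have xl' : idx x < idx l.
    rewrite ltn_neqAle xl andbT; apply: contraTneq bb => /(idx_inj uni) ->.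
    by case/leafP: ll => _ lo; rewrite inE (negbTE lo) andbF.
  (* The label of [l'] is one more than that of [l], so they differ; and [l] cannot lie between [x]
     and [l'], having the same label as [x]. *)
  have ll' : idx l' < idx l.
    rewrite ltnNge leq_eqVlt; apply/norP; split.
      apply: contraTneq isT => /(idx_inj uni) E.
      by have := matched_label mx; rewrite -E -lab => /eqP; rewrite -subr_eq0 opprD addNKr.
    apply/negP => lt; have := matched_between mx xl' (ltnW lt).
    by rewrite lab ltxx.
  have -> : face_perm m x = face_perm o l'.
    by rewrite face_perm_close face_stem //; have /leafP[/eqP] := matched_leaf mx; rewrite inE.
  rewrite (idx_face_lt uni ll'); split=> //.
  by apply: leq_trans (leqnSn _); apply: ltn_trans (matched_lt mx).
(* Past an earlier leaf at this label, the label would already be down to that of [mu l]. *)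
- have E : x = l.
    apply: (idx_inj uni); apply/eqP; move: xl; rewrite leq_eqVlt => /orP[//|lt].
    have := matched_between ml (x := face_perm o x).
    rewrite (idx_face_lt uni lt) label_face_leaf // lab (matched_label ml) addrK ltxx.
    by move=> H; have := H (leqW bx) lt.
  rewrite E face_perm_close -/b -face_stem; last by have /budP[/eqP] := matched_bud ml; rewrite inE.
  by rewrite (idx_face_lt uni (matched_lt ml)); split=> //; apply: matched_lt.
Qed.

(** In its face a leaf is the last corner met by the contour. *)
Lemma face_close_inj : {in leaves o &, injective (face m)}.
Proof.
move=> l l' ll ll' E.
have [] := face_close_leaf (x := l') ll; first by rewrite E porbit_id.
have [] := face_close_leaf (x := l) ll'; first by rewrite -E porbit_id.
move=> _ le _ _ le' _; apply: (idx_inj uni); apply/eqP.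
by rewrite eqn_leq le le'.
Qed.

Lemma face_close_root l : l \in leaves o -> face m l != face m (rootd o).
Proof.
move=> ll; apply/eqP => E.
have [] := face_close_leaf (x := rootd o) ll; first by rewrite E porbit_id.
by rewrite idx_root.
Qed.

(* The contour first enters a non-root face across a bud, whose leaf lies in
   that face. *)
Lemma face_close_surj h : face m h != face m (rootd o) ->
  exists2 l, l \in leaves o & face m l = face m h.
Proof.
move=> neq.
pose x := [arg min_(x < h in face m h) idx x].
have [xf xmin] : x \in face m h /\ (forall y, y \in face m h -> idx x <= idx y).
  by rewrite /x; case: arg_minnP => [|y]; rewrite ?porbit_id.
have xE : face m x = face m h by apply/eqP; rewrite eq_porbit_mem.
have xroot : x <> rootd o by move=> E; rewrite -xE E eqxx in neq.
have [p xp idxx] := idx_pred uni xroot.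
have early y : face m y = face m h -> idx y < idx x -> False.
  move=> /eqP; rewrite eq_porbit_mem => /xmin le lt.
  by have := leq_trans lt le; rewrite ltnn.
have [int|bb|ll] := dartP p.
- case: (early p); last by rewrite idxx.
  have xm : x = face_perm m p by rewrite face_perm_close closed_interior // -permM.
  by rewrite -xE [in RHS]xm /face porbit_step.
- have ml := closed_bud bb; exists (mu p); first exact: matched_leaf ml.
  rewrite -xE xp face_stem; last by have /budP[/eqP] := bb; rewrite inE.
  by rewrite -{2}(closedK p) -face_perm_close /face porbit_step.
- have ml := closed_leaf ll; case: (early (mu p)).
    rewrite -xE xp face_stem; last by have /leafP[/eqP] := ll; rewrite inE.
    by rewrite -{2}(closedK p) -face_perm_close /face porbit_step.
  by rewrite idxx ltnS ltnW // (matched_lt ml).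
Qed.


Lemma close_connected : connected m.
Proof.
apply/forallP => x; apply/forallP => y.
have := unicellular_connected uni; move/forallP/(_ x)/forallP/(_ y).
apply: connect_sub => {}x {}y /= /orP[/eqP->|/eqP->].
  by apply: connect1; rewrite /= eqxx.
have [->|int] := eqVneq (einv o x) x; first exact: connect0.
by apply: connect1; rewrite /= closed_interior // eqxx orbT.
Qed.

Lemma close_rooted_map : is_rooted_map m.
Proof.
apply/and3P; split; last exact: close_connected.
  by apply/forallP => h; rewrite /= closedK.
by apply/eqP/setP => h; rewrite !inE (negbTE (closed_neq h)).
Qed.

Definition even_faces : {set {set D}} := [set face m h | h in [pred h | (2 %| label o h)%Z]].

Lemma mem_even_faces h : (face m h \in even_faces) = (2 %| label o h)%Z.
Proof.
apply/imsetP/idP => [[x]|ev]; last by exists h.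
by rewrite inE => ev /label_same_face ->.
Qed.

Lemma even_faces_bicoloring : bicoloring m even_faces.
Proof.
apply/andP; split.
  by apply/subsetP => _ /imsetP[x _ ->]; apply: imset_f.
apply/forallP => h; rewrite !mem_even_faces /= label_closed label_vrot //.
by case: ifP; lia.
Qed.

Lemma close_bicolorable : bicolorable m.
Proof. by apply/existsP; exists even_faces; apply: even_faces_bicoloring. Qed.

(** [black_faces] picks some bicoloring with black root face. There is only one, since colors
    propagate from the root through the connected map: [vrot] is [mu], which flips the color,
    followed by a step inside a face. *)
Lemma black_faces_close : black_faces m = even_faces.
Proof.
rewrite /black_faces; case: pickP => [B /andP[/andP[subB /forallP colB] rootB]|/(_ even_faces)]; last first.
  by rewrite even_faces_bicoloring mem_even_faces label_rootd.
have agree h : (face m h \in B) = (face m h \in even_faces).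
  have /forallP/(_ (rootd m))/forallP/(_ h) := close_connected.
  case/connectP => p; elim/last_ind: p h => [|p x IH] h.
    by move=> _ ->; rewrite rootB mem_even_faces label_rootd.
  rewrite rcons_path last_rcons => /andP[pp step] ->.
  have {}IH := IH _ pp erefl; set y := last _ _ in step IH.
  have /andP[_ /forallP colE] := even_faces_bicoloring.
  have flip z : ((face m z \in B) = (face m z \in even_faces)) ->
      (face m (mu z) \in B) = (face m (mu z) \in even_faces).
    by have := colB z; have := colE z; rewrite /=; do 4!case: (_ \in _).
  case/orP: step => /eqP ->; last exact: flip.
  rewrite /= -{1 2}[y]closedK -face_perm_close /face porbit_step.
  exact: flip.
apply/setP => F; apply/idP/idP => FB.
  by have /imsetP[x _ E] := subsetP subB F FB; move: FB; rewrite E [porbit _ _]/(face m x) agree.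
by case/imsetP: (FB) => x _ E; move: FB; rewrite E agree.
Qed.

Lemma mem_black_faces h : (face m h \in black_faces m) = (2 %| label o h)%Z.
Proof. by rewrite black_faces_close mem_even_faces. Qed.

Lemma mem_faces F : reflect (exists h, F = face m h) (F \in faces m).
Proof.
by apply: (iffP imsetP) => [[h _ ->]|[h ->]]; exists h.
Qed.

Lemma stem_label_leaf l : l \in leaves o -> stem_label o l = label o l.
Proof.
move=> ll; rewrite /stem_label label_vrot //; have /leafP[_ /negbTE ->] := ll.
by lia.
Qed.

Lemma face_image_leaves : face m @: leaves o = faces m :\ face m (rootd o).
Proof.
apply/setP => F; rewrite in_setD1; apply/imsetP/andP => [[l ll ->]|[neq /mem_faces[h E]]].
  by split; [apply: face_close_root | apply/mem_faces; exists l].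
rewrite E in neq *; have [l ll <-] := face_close_surj neq.
by exists l.
Qed.

Lemma face_image_black_leaves :
  face m @: black_leaves o = black_faces m :\ face m (rootd o).
Proof.
apply/setP => F; apply/imsetP/idP => [[l]|].
  rewrite inE => /andP[ll ev] ->.
  by rewrite in_setD1 face_close_root //= mem_black_faces -stem_label_leaf.
rewrite in_setD1 black_faces_close => /andP[neq /imsetP[h ev E]].
rewrite E in neq *; have [l ll lh] := face_close_surj neq.
exists l => //; rewrite inE ll /= stem_label_leaf //.
by rewrite inE in ev; rewrite (label_same_face lh).
Qed.

Lemma face_image_white_leaves : face m @: white_leaves o = white_faces m.
Proof.
apply/setP => F; apply/imsetP/idP => [[l]|].
  rewrite in_setD inE => /andP[+ ll] ->; rewrite ll /= in_setD => odd.
  rewrite mem_black_faces -stem_label_leaf //; apply/andP; split=> //.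
  by apply/mem_faces; exists l.
rewrite in_setD => /andP[+ /mem_faces[h E]]; rewrite E mem_black_faces => odd.
have neq : face m h != face m (rootd o).
  by apply: contraNneq odd => /label_same_face ->; rewrite label_rootd.
have [l ll lh] := face_close_surj neq.
exists l => //; rewrite inE ll andbT inE ll /= stem_label_leaf //.
by rewrite (label_same_face lh).
Qed.

Lemma card_faces_close : #|faces m| = #|leaves o|.+1.
Proof.
rewrite (cardsD1 (face m (rootd o))) -face_image_leaves.
rewrite card_in_imset; last exact: face_close_inj.
by rewrite (_ : _ \in _) //; apply/mem_faces; exists (rootd o).
Qed.

Lemma card_black_faces_close : #|black_faces m| = #|black_leaves o|.+1.
Proof.
rewrite (cardsD1 (face m (rootd o))) -face_image_black_leaves.
rewrite card_in_imset; last first.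
  by move=> x y /setIdP[lx _] /setIdP[ly _]; apply: face_close_inj.
by rewrite mem_black_faces label_rootd.
Qed.

Lemma card_white_faces_close : #|white_faces m| = #|white_leaves o|.
Proof.
rewrite -face_image_white_leaves card_in_imset //.
by move=> x y /setDP[lx _] /setDP[ly _]; apply: face_close_inj.
Qed.

(** Both sides count the darts, which are the same in [o] and in its closure. *)
Lemma card_edges_close : #|edges m| = #|edges o| + #|leaves o|.
Proof.
have := involution_edges_card (m := m) closedK.
rewrite (involution_edges_card (opening_einvK Oo)).
have /and3P[_ /eqP -> _] := close_rooted_map; rewrite cards0 addn0.
rewrite -(cardsID (out o) (stems o)) -/(buds o) -/(leaves o).
have /and5P[_ _ /andP[/eqP <- _] _ _] := Oo.
by rewrite addnn -mul2n -mulnDr => /eqP; rewrite eqn_mul2l /= => /eqP.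
Qed.

(** Closing adds one edge and one face per leaf, so Euler's formula is unaffected. *)
Lemma genus_close g : genus_is g m = genus_is g o.
Proof.
rewrite /genus_is card_edges_close card_faces_close.
rewrite (eqP uni) [vertices m]/(vertices o).
by move: #|vertices o| #|edges o| #|leaves o| => V E L; apply/eqP/eqP; lia.
Qed.

Lemma blossoming_weight_close : blossoming_weight o = map_weight m.
Proof.
rewrite /blossoming_weight /map_weight card_edges_close card_black_faces_close.
by rewrite card_white_faces_close.
Qed.

Lemma is_BC_close g : genus_is g o -> is_BC g m.
Proof. by move=> go; rewrite /is_BC close_rooted_map genus_close go close_bicolorable. Qed.

End Closure.

(** * A blossoming map is determined by its closure *)

Section Injectivity.
Variable D : finType.
Implicit Types (o : blossoming D) (h x y : D).

(** Induction on the label in [o2]: a non-root face has a leaf of [o2], across which the label of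
    [o2] drops by one while that of [o1] drops by at most one. By symmetry the labels coincide. *)
Lemma label_le o1 o2 : opening o1 -> opening o2 -> close_map o1 = close_map o2 ->
  forall h, (label o1 h <= label o2 h)%R.
Proof.
move=> O1 O2 eq12 h.
have [n] := ubnP (absz (label o2 h)); elim: n h => // n IH h ltn.
have [E|neq] := eqVneq (face (close_map o2) h) (face (close_map o2) (rootd o2)).
  rewrite (label_same_face O2 E) label_rootd; move: E; rewrite -eq12.
  rewrite (_ : rootd o2 = rootd o1) => [/(label_same_face O1) ->|]; first by rewrite label_rootd.
  by case: eq12.
have [l ll lh] := face_close_surj O2 neq.
rewrite -(label_same_face O2 lh) in ltn *.
have -> : label o1 h = label o1 l by apply: (label_same_face O1); rewrite eq12.
have {}IH : (label o1 (vrot o2 l) <= label o2 (vrot o2 l))%R.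
  apply: IH; have := label_ge0 O2 (vrot o2 l); rewrite label_vrot //.
  by have /leafP[_ /negbTE ->] := ll; lia.
move: IH; rewrite (label_vrot O2); have /leafP[_ /negbTE ->] := ll.
rewrite (_ : vrot o2 = vrot o1); last by case: eq12.
by rewrite (label_vrot O1); case: ifP; lia.
Qed.

(** A bud precedes its leaf, whereas [well_oriented] makes an interior edge be traversed first
    against its orientation. Hence the order of the contour tells which edges of the closure are
    cut. *)
Lemma stem_index o h : opening o ->
  (einv o h == h) = ((h \in out o) == (index h (contour o) < index (closed_einv o h) (contour o))).
Proof.
move=> Oo; have [int|bb|ll] := dartP o h; last 2 first.
- by have /budP[-> ->] := bb; rewrite eqxx (matched_lt (closed_bud Oo bb)).
- have /leafP[-> /negbTE ->] := ll; have /ltnW le := matched_lt (closed_leaf Oo ll).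
  by rewrite ltnNge le !eqxx.
rewrite (negbTE int) closed_interior //.
have /and5P[_ _ _ _ /forallP wo] := Oo.
have := wo h; have := wo (einv o h); rewrite (opening_einvK Oo) eq_sym int /= opening_interior_out //.
case: ltngtP => [_|_|/(idx_inj (opening_unicellular Oo)) E].
- by case: (h \in out o).
- by case: (h \in out o).
- by rewrite E eqxx in int.
Qed.

Lemma close_map_inj o1 o2 : opening o1 -> opening o2 ->
  close_map o1 = close_map o2 -> o1 = o2.
Proof.
move=> O1 O2 eq12.
have rotE : vrot o1 = vrot o2 by case: eq12.
have rootE : rootd o1 = rootd o2 by case: eq12.
have muE : closed_einv o1 = closed_einv o2 by case: eq12.
have labelE h : label o1 h = label o2 h.
  by apply: le_anti; rewrite (label_le O1 O2 eq12) (label_le O2 O1 (esym eq12)).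
have outE : out o1 = out o2.
  apply/setP => h; have := label_vrot O1 h; rewrite rotE !labelE (label_vrot O2).
  by do 2!case: (_ \in _) => //; move/addrI.
have uni1 := opening_unicellular O1; have uni2 := opening_unicellular O2.
pose idx1 h := index h (contour o1); pose idx2 h := index h (contour o2).
(* Whether [h] is a stem depends on whether its partner comes later, which the common beginning of
   the two contours up to [h] decides. *)
have einvE h : (forall x, idx1 x <= idx1 h -> idx1 x = idx2 x) ->
    (forall x, idx2 x <= idx1 h -> idx1 x = idx2 x) -> einv o1 h = einv o2 h.
  move=> H1 H2; have := stem_index h O1; have := stem_index h O2.
  rewrite outE muE -[index h (contour o2)]/(idx2 h) -[index h (contour o1)]/(idx1 h).
  rewrite -[index _ (contour o2)]/(idx2 _) -[index _ (contour o1)]/(idx1 _).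
  have -> : (idx2 h < idx2 (closed_einv o2 h)) = (idx1 h < idx1 (closed_einv o2 h)).
    rewrite -(H1 h) // !ltnNge; congr (~~ _).
    by apply/idP/idP => [/[dup] /H2 <-|/[dup] /H1 ->].
  move=> <-; have [-> /eqP //|int2] := eqVneq (einv o2 h) h.
  by move=> /negbT int1; rewrite -(closed_interior O1) // -(closed_interior O2) // muE.
have idx_rootE : idx1 (rootd o1) = idx2 (rootd o1).
  by rewrite /idx1 idx_root rootE /idx2 idx_root.
(* Both halves are carried along because a partner might a priori come early in only one of the two
   contours. *)
have idxE n : (forall h, idx1 h < n -> idx1 h = idx2 h) /\
              (forall h, idx2 h < n -> idx1 h = idx2 h).
  elim: n => [//|n [IH1 IH2]]; split=> h.
    have [->//|/eqP neq] := eqVneq h (rootd o1).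
    have [p hE hi] := idx_pred uni1 neq.
    rewrite /idx1 hi ltnS => ltp; have pE := IH1 p ltp.
    have eE : einv o1 p = einv o2 p.
      by apply: einvE => x lex; [apply: IH1 | apply: IH2]; apply: leq_ltn_trans lex ltp.
    have fE : face_perm o1 p = face_perm o2 p by rewrite !permM eE rotE.
    rewrite -/(idx1 p) pE hE fE /idx2 idx_face // -fE -hE -rootE.
    exact: neq.
  have [->|/eqP neq] := eqVneq h (rootd o2); first by rewrite -rootE.
  have [p hE hi] := idx_pred uni2 neq.
  rewrite /idx2 hi ltnS => ltp; have pE := IH2 p ltp.
  have eE : einv o1 p = einv o2 p.
    by apply: einvE => x; rewrite pE => lex; [apply: IH1 | apply: IH2]; apply: leq_ltn_trans lex ltp.
  have fE : face_perm o1 p = face_perm o2 p by rewrite !permM eE rotE.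
  rewrite -/(idx2 p) -pE hE -fE /idx1 idx_face // fE -hE rootE.
  exact: neq.
have einvE' : einv o1 = einv o2.
  apply/permP => h; apply: einvE => x _.
    by have [H _] := idxE (idx1 x).+1; apply: H.
  by have [H _] := idxE (idx1 x).+1; apply: H.
clear -rotE rootE outE einvE'.
by case: o1 o2 rotE rootE outE einvE' => [[? ? ?] ?] [[? ? ?] ?] /= -> -> -> ->.
Qed.

End Injectivity.

(** * Invariance of the closure under renaming of darts *)

Section Renaming.
Variable D : finType.
Implicit Types (s t : {perm D}) (p : {perm D}) (o : blossoming D) (m : premap D).

Lemma porbitJ p s x : porbit (p ^ s)%g (s x) = s @: porbit p x.
Proof.
apply/setP => y; apply/porbitP/imsetP => [[i ->]|[_ /porbitP[i ->] ->]].
  by exists ((p ^+ i)%g x); rewrite ?mem_porbit // -conjXg permJ.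
by exists i; rewrite -conjXg permJ.
Qed.

Lemma card_porbitsJ p s : #|porbits (p ^ s)%g| = #|porbits p|.
Proof.
have inj : injective (fun A : {set D} => s @: A) by apply/imset_inj/perm_inj.
rewrite -[RHS](card_imset _ inj); congr #|pred_of_set _|.
apply/setP => A; apply/imsetP/imsetP => [[x _ ->]|[_ /imsetP[x _ ->] ->]].
  exists (porbit p (s^-1 x)%g); first exact: imset_f.
  by rewrite -porbitJ permKV.
by exists (s x); rewrite // porbitJ.
Qed.

Lemma fingraph_order_porbit p x : fingraph.order p x = #|porbit p x|.
Proof. by apply: eq_card => y; rewrite inE -mem_fingraph_orbit -fconnect_orbit. Qed.

Variable s : {perm D}.

Lemma forall_perm (P : D -> Prop) : (forall h, P (s h)) -> forall h, P h.
Proof. by move=> H h; rewrite -[h](permKV s). Qed.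

Section BRename.
Variable o : blossoming D.
Local Notation o' := (brename s o).

Lemma einv_brename h : einv o' (s h) = s (einv o h).
Proof. exact: permJ. Qed.

Lemma vrot_brename h : vrot o' (s h) = s (vrot o h).
Proof. exact: permJ. Qed.

Lemma face_perm_brename : face_perm o' = (face_perm o ^ s)%g.
Proof. by rewrite /face_perm conjMg. Qed.

Lemma out_brename h : (s h \in out o') = (h \in out o).
Proof. by rewrite mem_imset //; apply: perm_inj. Qed.

Lemma contour_brename : contour o' = map s (contour o).
Proof.
rewrite /contour /fingraph.orbit !fingraph_order_porbit face_perm_brename.
rewrite porbitJ card_imset; last exact: perm_inj.
move: #|porbit _ _| => n /=; elim: n (rootd o) => //= n IH x.
by rewrite -IH permJ.
Qed.

Lemma index_brename h : index (s h) (contour o') = index h (contour o).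
Proof. by rewrite contour_brename index_map //; apply: perm_inj. Qed.

Lemma buds_brename h : (s h \in buds o') = (h \in buds o).
Proof. by rewrite !in_setI out_brename !inE einv_brename (inj_eq perm_inj). Qed.

Lemma leaves_brename h : (s h \in leaves o') = (h \in leaves o).
Proof. by rewrite !in_setD out_brename !inE einv_brename (inj_eq perm_inj). Qed.

Lemma label_brename h : label o' (s h) = label o h.
Proof.
rewrite /label index_brename contour_brename -map_take big_map.
by apply: eq_bigr => x _; rewrite /contour_step buds_brename leaves_brename.
Qed.

Lemma matched_brename b l : matched o' (s b) (s l) = matched o b l.
Proof.
rewrite /matched buds_brename leaves_brename !index_brename !label_brename.
do 4!congr (_ && _); apply/forallP/forallP => H x.
  by have := H (s x); rewrite index_brename label_brename.
by move: x; apply: forall_perm => x; rewrite index_brename label_brename.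
Qed.

Hypothesis Oo : opening o.

Lemma opening_brename : opening o'.
Proof.
have uni' : unicellular o'.
  rewrite /unicellular /faces face_perm_brename card_porbitsJ.
  exact: opening_unicellular Oo.
apply/and5P; split=> //.
- apply/and4P; split.
  + apply/forallP; apply: forall_perm => h.
    by rewrite !einv_brename (opening_einvK Oo).
  + apply/forallP; apply: forall_perm => h; rewrite einv_brename !out_brename.
    rewrite (inj_eq perm_inj); apply/implyP => /(opening_interior_out Oo) ->.
    by case: (_ \in _).
  + exact: unicellular_connected.
  + by rewrite buds_brename opening_rootd_bud.
- apply/andP; split; last first.
    by apply/forallP; apply: forall_perm => h; rewrite label_brename label_ge0.
  have -> : leaves o' = s @: leaves o.
    apply/setP; apply: forall_perm => h.
    by rewrite leaves_brename mem_imset //; apply: perm_inj.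
  have -> : buds o' = s @: buds o.
    apply/setP; apply: forall_perm => h.
    by rewrite buds_brename mem_imset //; apply: perm_inj.
  rewrite !card_imset; try exact: perm_inj.
  by have /and5P[_ _ /andP[]] := Oo.
- have /and5P[_ _ _ /andP[/forallP H1 /forallP H2] _] := Oo.
  apply/andP; split; apply/forallP; apply: forall_perm => h.
    by rewrite face_perm_brename permJ einv_brename (inj_eq perm_inj) !label_brename.
  by rewrite vrot_brename out_brename !label_brename.
- have /and5P[_ _ _ _ /forallP H] := Oo.
  apply/forallP; apply: forall_perm => h.
  by rewrite einv_brename (inj_eq perm_inj) !index_brename out_brename.
Qed.

(** Instead of following the mergings through the renaming, this uses that partners are determined
    by [matched], which is invariant. *)
Lemma closed_einv_brename h : closed_einv o' (s h) = s (closed_einv o h).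
Proof.
have O' := opening_brename; have [int|bb|ll] := dartP o h.
- by rewrite !closed_interior ?einv_brename ?(inj_eq perm_inj).
- apply: (matched_leaf_inj O' (b := s h)).
    by apply: closed_bud; rewrite ?buds_brename.
  by rewrite matched_brename closed_bud.
- apply: (matched_bud_inj O' (l := s h)).
    by apply: closed_leaf; rewrite ?leaves_brename.
  by rewrite matched_brename closed_leaf.
Qed.

Lemma close_brename : close_map o' = rename s (close_map o).
Proof.
congr PreMap; apply/permP; apply: forall_perm => h.
by rewrite closed_einv_brename permJ.
Qed.

End BRename.
End Renaming.

(** * Closure of isomorphism classes *)

Section Classes.
Variable D : finType.
Implicit Types (s t : {perm D}) (o : blossoming D) (m : premap D).

Lemma rename1 m : rename 1%g m = m.
Proof. by case: m => v e r; rewrite /rename !conjg1 perm1. Qed.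

Lemma renameM s t m : rename t (rename s m) = rename (s * t)%g m.
Proof. by rewrite /rename /= !conjgM permM. Qed.

Lemma brenameM s t o : brename t (brename s o) = brename (s * t)%g o.
Proof.
rewrite /brename renameM -imset_comp; congr Blossoming.
by apply: eq_imset => x; rewrite permM.
Qed.

Lemma map_class_refl m : m \in map_class m.
Proof. by rewrite -[X in X \in _]rename1; apply: imset_f. Qed.

Lemma blossoming_class_brename s o :
  blossoming_class (brename s o) = blossoming_class o.
Proof.
apply/setP => x; apply/imsetP/imsetP => -[t _ ->].
  by exists (s * t)%g; rewrite // brenameM.
by exists (s^-1 * t)%g; rewrite // brenameM mulKVg.
Qed.

(** This makes [chi] meaningful: the image of a class is a whole class. *)
Lemma close_blossoming_class o : opening o ->
  @close_map D @: blossoming_class o = map_class (close_map o).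
Proof.
move=> Oo; rewrite /blossoming_class /map_class -imset_comp.
by apply: eq_imset => s; rewrite /= close_brename.
Qed.

Lemma blossoming_class_close_inj o1 o2 : opening o1 -> opening o2 ->
  map_class (close_map o1) = map_class (close_map o2) ->
  blossoming_class o1 = blossoming_class o2.
Proof.
move=> O1 O2 E; have := map_class_refl (close_map o1); rewrite E => /imsetP[s _ Es].
rewrite -(blossoming_class_brename s o2); congr blossoming_class.
apply: close_map_inj => //; first exact: opening_brename.
by rewrite close_brename.
Qed.

End Classes.

(** * Dual distance to the root face and the orientation it induces *)

Section Distance.
Variables (D : finType) (m : premap D).
Hypothesis rooted_m : is_rooted_map m.
Implicit Types h x y : D.

Lemma rooted_map_einvK h : einv m (einv m h) = h.
Proof. by have /and3P[/forallP/(_ h)/eqP] := rooted_m. Qed.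

Lemma rooted_map_einv_neq h : einv m h != h.
Proof.
have /and3P[_ /eqP/setP/(_ h) st _] := rooted_m.
by move: st; rewrite !inE => ->.
Qed.

Lemma face_perm_einv h : face_perm m (einv m h) = vrot m h.
Proof. by rewrite permM rooted_map_einvK. Qed.

(** The ball of radius [k] around the root face in the dual graph, encoded as the set of darts of
    its faces. *)
Fixpoint face_ball (k : nat) : {set D} :=
  if k is k'.+1 then
    face_ball k' :|: [set h | [exists x in face m h, einv m x \in face_ball k']]
  else face m (rootd m).

Lemma face_ball_face k x y : face m x = face m y ->
  (x \in face_ball k) = (y \in face_ball k).
Proof.
move=> E; elim: k => [|k IH] /=; first by rewrite /face -!eq_porbit_mem -!/(face m _) E.
by rewrite !in_setU IH !inE E.
Qed.

Lemma face_ball_einv k h : h \in face_ball k -> einv m h \in face_ball k.+1.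
Proof.
move=> hk; rewrite /= !inE; apply/orP; right; apply/existsP; exists (einv m h).
by rewrite /face porbit_id rooted_map_einvK.
Qed.

Lemma face_ball_leq k k' : k <= k' -> face_ball k \subset face_ball k'.
Proof.
move/subnK <-; elim: (k' - k) => //= i IH.
by apply: subset_trans IH _; apply: subsetUl.
Qed.

Lemma face_step h : face m (face_perm m h) = face m h.
Proof. exact: porbit_step. Qed.

Lemma face_ball_exists h : exists k, h \in face_ball k.
Proof.
have /and3P[_ _ /forallP/(_ (rootd m))/forallP/(_ h)/connectP[p]] := rooted_m.
elim/last_ind: p h => [h _ ->|p x IH h]; first by exists 0; apply: porbit_id.
rewrite rcons_path last_rcons => /andP[/IH/(_ erefl)[k yk] step] ->.
exists k.+1; case/orP: step => /eqP ->; last exact: face_ball_einv.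
by rewrite -face_perm_einv (face_ball_face _ (face_step _)) face_ball_einv.
Qed.

Definition face_dist h : nat := ex_minn (face_ball_exists h).

Lemma face_dist_leq h k : (face_dist h <= k) = (h \in face_ball k).
Proof.
rewrite /face_dist; case: ex_minnP => d hd min.
by apply/idP/idP => [/face_ball_leq/subsetP|]; [apply | apply: min].
Qed.

Lemma face_dist_face x y : face m x = face m y -> face_dist x = face_dist y.
Proof.
move=> E; apply/eqP; rewrite eqn_leq !face_dist_leq.
by rewrite (face_ball_face _ E) -(face_ball_face (face_dist x) E) -!face_dist_leq !leqnn.
Qed.

Lemma face_dist_face_perm h : face_dist (face_perm m h) = face_dist h.
Proof. exact/face_dist_face/face_step. Qed.

Lemma face_dist_vrot h : face_dist (vrot m h) = face_dist (einv m h).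
Proof. by rewrite -face_perm_einv face_dist_face_perm. Qed.

Lemma face_dist_eq0 h : (face_dist h == 0) = (face m h == face m (rootd m)).
Proof. by rewrite -leqn0 face_dist_leq /= eq_porbit_mem. Qed.

Lemma face_dist_einv_leq h : face_dist (einv m h) <= (face_dist h).+1.
Proof. by rewrite face_dist_leq face_ball_einv // -face_dist_leq. Qed.

Lemma face_dist_pred h k : face_dist h = k.+1 ->
  exists2 x, face m x = face m h & face_dist (einv m x) = k.
Proof.
move=> hk; have: h \in face_ball k.+1 by rewrite -face_dist_leq hk.
rewrite /= inE -face_dist_leq hk ltnn /= inE => /existsP[x /andP[xh]].
rewrite -face_dist_leq => le.
have E : face m x = face m h by apply/eqP; rewrite eq_porbit_mem.
exists x => //; apply/eqP; rewrite eqn_leq le /=.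
by have := face_dist_einv_leq (einv m x); rewrite rooted_map_einvK (face_dist_face E) hk.
Qed.

Hypothesis bicolorable_m : bicolorable m.

(** The distance of a face is odd exactly when its color differs from that of the root face, by
    induction along a geodesic. In particular the two sides of an edge are never at the same
    distance. *)
Lemma odd_face_dist_einv h : odd (face_dist (einv m h)) = ~~ odd (face_dist h).
Proof.
have /existsP[B /andP[_ /forallP colB]] := bicolorable_m.
have parity x : odd (face_dist x) = (face m x \in B) (+) (face m (rootd m) \in B).
  move: {2}(face_dist x) (erefl (face_dist x)) => k.
  elim: k x => [|k IH] x xk.
    by move/eqP: (xk); rewrite face_dist_eq0 xk => /eqP ->; rewrite addbb.
  have [y yx yk] := face_dist_pred xk.
  have := IH _ yk; rewrite xk yk -yx /= => ->.
  by have := colB y; do 3!case: (_ \in _).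
rewrite !parity; have := colB h.
by do 3!case: (_ \in _).
Qed.

(** The face of [h] is on the right of [h] and that of [einv m h] on its left, so the larger
    distance is on the left. *)
Definition geodesic_out : {set D} := [set h | face_dist h < face_dist (einv m h)].

Lemma geodesic_out_einv h : (einv m h \in geodesic_out) = (h \notin geodesic_out).
Proof.
rewrite !inE rooted_map_einvK -leqNgt [RHS]leq_eqVlt.
by case: eqP => // E; have := odd_face_dist_einv h; rewrite E; case: odd.
Qed.

Lemma face_dist_out h :
  h \in geodesic_out -> face_dist (einv m h) = (face_dist h).+1.
Proof. by rewrite inE => lt; apply/eqP; rewrite eqn_leq face_dist_einv_leq. Qed.

Lemma face_dist_notin h :
  h \notin geodesic_out -> face_dist h = (face_dist (einv m h)).+1.
Proof. by rewrite -geodesic_out_einv => /face_dist_out; rewrite rooted_map_einvK. Qed.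

End Distance.

(** * Opening a bicolorable map by exploration *)

Section Opening.
Variables (D : finType) (m : premap D).
Hypotheses (rooted_m : is_rooted_map m) (bicolorable_m : bicolorable m).
Implicit Types h x y : D.
Local Notation dist := (face_dist rooted_m).
Local Notation outm := (geodesic_out rooted_m).

(* A state is the list of visited corners and the current corner. The edge of
   the current corner is cut if it is first reached along its orientation and
   kept otherwise; contour steps follow this decision. *)
Definition explore_step (st : seq D * D) : seq D * D :=
  let: (hist, h) := st in
  (rcons hist h,
   if (h \in outm) == (einv m h \in hist) then vrot m (einv m h) else vrot m h).

Definition explore k := iter k explore_step ([::], rootd m).
Definition explored k := (explore k).2.

Lemma explore_history k : (explore k).1 = mkseq explored k.
Proof.
elim: k => // k IH; rewrite /mkseq -[k.+1]addn1 iotaD map_cat add0n /= cats1.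
by rewrite -[map _ _]IH addn1 /explore /= /explored /explore; case: (iter _ _ _).
Qed.

Lemma exploredS k : explored k.+1 =
  if (explored k \in outm) == (einv m (explored k) \in mkseq explored k)
  then vrot m (einv m (explored k)) else vrot m (explored k).
Proof.
by rewrite -explore_history /explored /explore /=; case: (iter _ _ _).
Qed.

Lemma mkseqS (f : nat -> D) n : mkseq f n.+1 = rcons (mkseq f n) (f n).
Proof. by rewrite /mkseq -addn1 iotaD map_cat cats1. Qed.

Lemma explored_returns : exists k, explored k \in mkseq explored k.
Proof.
apply: contrapT => /forallNP none.
have uniqs n : uniq (mkseq explored n).
  elim: n => // n IH; rewrite mkseqS rcons_uniq IH andbT.
  exact/negP/none.
have := max_card [in mkseq explored #|D|.+1].
by rewrite (card_uniqP (uniqs _)) size_mkseq ltnn.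
Qed.

(** The time of the first repetition of a corner. *)
Definition explored_size := ex_minn explored_returns.
Local Notation N := explored_size.
Definition visited : seq D := mkseq explored N.
Local Notation ix h := (index h visited).

Lemma size_visited : size visited = N. Proof. exact: size_mkseq. Qed.

Lemma visited_uniq : uniq visited.
Proof.
rewrite /visited /N; case: ex_minnP => n _ min.
suff: forall k, k <= n -> uniq (mkseq explored k) by apply.
elim=> // k IH lt; rewrite mkseqS rcons_uniq IH ?andbT; last exact: ltnW.
by apply/negP => /min; rewrite leqNgt lt.
Qed.

Lemma take_visited k : k <= N -> take k visited = mkseq explored k.
Proof. by move=> le; rewrite -map_take take_iota (minn_idPl le). Qed.

Lemma index_explored k : k < N -> ix (explored k) = k.
Proof.
move=> lt; rewrite -[explored k](nth_mkseq (rootd m) explored lt).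
by rewrite index_uniq ?visited_uniq // size_visited.
Qed.

Lemma visited_explored h : h \in visited -> explored (ix h) = h.
Proof.
move=> hv; rewrite -[RHS](nth_index (rootd m) hv) nth_mkseq //.
by rewrite -size_visited index_mem.
Qed.

(** An unvisited dart has index [N] and so counts as later than every visited one; the first
    conjunct excludes edges with both halves unvisited. *)
Definition kept h := (ix h != ix (einv m h)) && ((h \in outm) == (ix (einv m h) < ix h)).

Lemma kept_einv h : kept (einv m h) = kept h.
Proof.
rewrite /kept rooted_map_einvK // (geodesic_out_einv rooted_m bicolorable_m).
by case: ltngtP => //; case: (h \in outm).
Qed.

Definition kept_fun h := if kept h then einv m h else h.

Lemma kept_funK : involutive kept_fun.
Proof.
move=> h; rewrite /kept_fun; case E: (kept h); last by rewrite E.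
by rewrite kept_einv E rooted_map_einvK.
Qed.

Definition kept_einv_perm : {perm D} := perm (can_inj kept_funK).

Definition open_map : blossoming D :=
  Blossoming (PreMap (vrot m) kept_einv_perm (rootd m)) outm.
Local Notation o := open_map.

Lemma einv_open h : einv o h = if kept h then einv m h else h.
Proof. by rewrite permE. Qed.

Lemma face_perm_open h : face_perm o h = vrot m (if kept h then einv m h else h).
Proof. by rewrite permM permE. Qed.

Lemma index_einv_neq h : h \in visited -> ix h != ix (einv m h).
Proof.
move=> hv; apply: contraTneq (rooted_map_einv_neq rooted_m h) => E.
rewrite negbK; apply/eqP; rewrite -[RHS](visited_explored hv) E visited_explored //.
by rewrite -index_mem -E index_mem.
Qed.

(** The decision taken at time [k] from the history agrees with the final comparison of indices, so
    the exploration follows the permutation [face_perm o]. *)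
Lemma explored_face k : k < N -> explored k.+1 = face_perm o (explored k).
Proof.
move=> lt; rewrite exploredS face_perm_open /kept.
rewrite index_einv_neq; last by rewrite map_f // mem_iota.
rewrite index_explored // -take_visited; last exact: ltnW.
rewrite in_take_leq; last by rewrite size_visited ltnW.
by case: ifP.
Qed.

(** Steps are injective: if the first repeated corner were some [explored j.+1], its predecessor
    would have been repeated before. *)
Lemma explored_end : explored N = rootd m.
Proof.
have: explored N \in mkseq explored N by rewrite /N; case: ex_minnP.
case/mapP => -[//|j]; rewrite mem_iota add0n /= => ltj.
have ltN : N.-1 < N by case: N ltj.
rewrite -{1}(ltn_predK ltj) !explored_face //; last exact: ltnW.
move=> /perm_inj /(congr1 (fun h => ix h)); rewrite !index_explored //; last exact: ltnW.
by move: ltj => /[swap] <-; rewrite (ltn_predK ltN) ltnn.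
Qed.

Lemma visited_face h : h \in visited -> face_perm o h \in visited.
Proof.
move=> hv; have lt : ix h < N by rewrite -size_visited index_mem.
rewrite -(visited_explored hv) -explored_face //.
move: lt; rewrite leq_eqVlt => /orP[/eqP ->|lt].
  rewrite explored_end -[rootd m]/(explored 0) map_f // mem_iota /=.
  by rewrite -size_visited; case: visited hv.
by rewrite map_f // mem_iota.
Qed.

Lemma dist_face_open h : dist (face_perm o h) =
  if kept h then dist h else dist (einv m h).
Proof.
rewrite face_perm_open; case: ifP => _; last by rewrite face_dist_vrot.
by rewrite -[vrot m _]permM face_dist_face_perm.
Qed.

(** A half-edge pointing to its vertex is cut only if its partner was reached before it. *)
Lemma visited_leaf_bud h : h \in visited -> ~~ kept h -> h \notin outm ->
  einv m h \in visited.
Proof.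
move=> hv; rewrite /kept index_einv_neq //= => + ho; rewrite (negbTE ho) /=.
case: ltnP => // lt _; rewrite -index_mem; apply: ltn_trans lt _.
by rewrite index_mem.
Qed.

Definition cut_visited (b : bool) : {set D} :=
  [set h in visited | ~~ kept h && ((h \in outm) == b)].

Lemma in_cut_visited b h :
  (h \in cut_visited b) = [&& h \in visited, ~~ kept h & (h \in outm) == b].
Proof. by rewrite inE. Qed.

(* The distances along the closed exploration sum up to zero, hence as many
   visited leaves as visited buds. *)
Lemma card_cut_visited : #|cut_visited true| = #|cut_visited false|.
Proof.
have reindex : \sum_(h in visited) dist (face_perm o h) = \sum_(h in visited) dist h.
  rewrite -(big_imset (fun h => dist h)) /=; last by move=> x y _ _; apply: perm_inj.
  apply: eq_bigl => x; suff -> : face_perm o @: [in visited] = [set h in visited] by rewrite inE.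
  apply/eqP; rewrite eqEcard; apply/andP; split.
    by apply/subsetP => _ /imsetP[h hv ->]; rewrite inE visited_face.
  rewrite card_imset; last exact: perm_inj.
  by rewrite cardsE.
(* Distances are natural numbers, so decreases at leaves are recorded as additions on the left. *)
have: \sum_(h in visited) (dist (face_perm o h) + (h \in cut_visited false)) =
      \sum_(h in visited) (dist h + (h \in cut_visited true)).
  apply: eq_bigr => h hv; rewrite dist_face_open !in_cut_visited hv /=.
  case: ifP => //= _; have [ho|ho] := boolP (h \in outm).
    by rewrite addn0 face_dist_out // addn1.
  by rewrite addn0 [in RHS](face_dist_notin bicolorable_m ho) addn1.
rewrite !big_split /= reindex => /eqP; rewrite eqn_add2l => /eqP.
have cardE b : \sum_(h in visited) (h \in cut_visited b) = #|cut_visited b|.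
  rewrite -sum1_card big_mkcond [RHS]big_mkcond; apply: eq_bigr => h _.
  by rewrite in_cut_visited; case: (h \in visited) => //=; case: ifP.
by rewrite !cardE.
Qed.

(** Visited leaves are sent by [einv m] injectively to visited buds; as the numbers agree, every
    visited bud is reached. *)
Lemma visited_cut h : h \in visited -> ~~ kept h -> einv m h \in visited.
Proof.
move=> hv hk; have [ho|] := boolP (h \in outm); last exact: visited_leaf_bud.
have sub : einv m @: cut_visited false \subset cut_visited true.
  apply/subsetP => _ /imsetP[x + ->]; rewrite !in_cut_visited => /and3P[xv xk /eqP xo].
  by rewrite visited_leaf_bud ?xo // kept_einv xk (geodesic_out_einv rooted_m bicolorable_m) xo.
have : einv m @: cut_visited false == cut_visited true.
  rewrite eqEcard sub card_cut_visited card_imset ?leqnn //; exact: perm_inj.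
move=> /eqP/setP/(_ h); rewrite in_cut_visited hv hk ho /= => /imsetP[x + ->].
by rewrite in_cut_visited rooted_map_einvK // => /andP[].
Qed.

Lemma visited_map_face h : h \in visited -> face_perm m h \in visited.
Proof.
move=> hv; rewrite permM; case E: (kept h).
  by have := visited_face hv; rewrite face_perm_open E.
have ev : einv m h \in visited by rewrite visited_cut ?E.
by have := visited_face ev; rewrite face_perm_open kept_einv E.
Qed.

Lemma visited_map_face_eq x y : face m x = face m y -> x \in visited -> y \in visited.
Proof.
move=> /eqP; rewrite eq_sym eq_porbit_mem => + xv.
by apply: (porbit_ind (P := fun y => y \in visited)) => // z; apply: visited_map_face.
Qed.

Lemma visited_rootd : rootd m \in visited.
Proof.
rewrite -[rootd m]/(explored 0) map_f // mem_iota /= /N.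
by case: ex_minnP => -[].
Qed.

Lemma visited_all h : h \in visited.
Proof.
move: {2}(dist h) (erefl (dist h)) => k; elim: k h => [|k IH] h hk.
  apply: (visited_map_face_eq _ visited_rootd).
  by apply/esym/eqP; rewrite -(face_dist_eq0 rooted_m) hk.
have [x xh xk] := face_dist_pred hk.
apply: (visited_map_face_eq xh).
have ev := IH _ xk; apply: contraT => xv.
(* If [x] is unvisited, the edge is reached first from [einv m x], on the side closer to the root,
   hence along its orientation; it is therefore cut, and [visited_cut] applies. *)
have lt : ix (einv m x) < ix x.
  by rewrite [X in _ < X]memNindex // index_mem.
suff : x \in visited by rewrite (negbTE xv).
rewrite -[x](rooted_map_einvK rooted_m) visited_cut // /kept.
rewrite rooted_map_einvK // inE rooted_map_einvK // xk (face_dist_face rooted_m xh) hk ltnSn.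
by rewrite [ix x < _]ltnNge (ltnW lt) andbF.
Qed.

Lemma open_unicellular : unicellular o.
Proof.
have all_orbit h : h \in porbit (face_perm o) (rootd m).
  rewrite -(visited_explored (visited_all h)).
  have: ix h < N by rewrite -size_visited index_mem visited_all.
  elim: (ix h) => [_|k IH lt]; first exact: porbit_id.
  have {}IH := IH (ltnW lt).
  by rewrite explored_face ?(ltnW lt) // -eq_porbit_mem porbit_step eq_porbit_mem.
apply/cards1P; exists (porbit (face_perm o) (rootd m)).
apply/setP => F; rewrite inE; apply/imsetP/eqP => [[x _ ->]|->]; last by exists (rootd m).
by apply/eqP; rewrite eq_porbit_mem.
Qed.

Lemma contour_open : contour o = visited.
Proof.
have sizeE : fingraph.order (face_perm o) (rootd o) = N.
  rewrite -size_orbit -size_visited -!(card_uniqP _) ?visited_uniq ?contour_uniq //.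
  by apply: eq_card => h; rewrite visited_all mem_contour // open_unicellular.
rewrite /contour /fingraph.orbit sizeE.
apply: (@eq_from_nth _ (rootd m)); rewrite size_traject ?size_visited // => i lti.
rewrite nth_traject // nth_mkseq //.
elim: i lti => // i IH lt; rewrite iterS IH; last exact: ltnW.
by rewrite -explored_face // ltnW.
Qed.

Lemma bud_open h : (h \in buds o) = ~~ kept h && (h \in outm).
Proof.
rewrite in_setI [h \in stems o]inE einv_open; case: ifP; rewrite ?eqxx //.
by rewrite (negbTE (rooted_map_einv_neq rooted_m h)).
Qed.

Lemma leaf_open h : (h \in leaves o) = ~~ kept h && (h \notin outm).
Proof.
rewrite in_setD [h \in stems o]inE einv_open andbC; case: ifP; rewrite ?eqxx //.
by rewrite (negbTE (rooted_map_einv_neq rooted_m h)).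
Qed.

Lemma dist_step_open h :
  ((dist (face_perm o h))%:Z = (dist h)%:Z + contour_step o h)%R.
Proof.
rewrite dist_face_open /contour_step bud_open leaf_open.
case: ifP => _ /=; first by rewrite addr0.
have [ho|ho] := boolP (h \in outm) => /=.
  by rewrite face_dist_out // -addn1 PoszD.
by rewrite [in RHS](face_dist_notin bicolorable_m ho) -addn1 PoszD addrK.
Qed.

(** Both sides vanish at the root and change by [contour_step] along the contour. *)
Lemma label_open h : label o h = (dist h)%:Z%R.
Proof.
rewrite /label contour_open -{2}(visited_explored (visited_all h)).
have: ix h < N by rewrite -size_visited index_mem visited_all.
move: (ix h) => k /ltnW ltk; rewrite take_visited //.
elim: k ltk => [_|k IH lt].
  rewrite big_nil -[explored 0]/(rootd m); apply/esym/eqP.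
  by rewrite eqz_nat face_dist_eq0.
rewrite mkseqS -cats1 big_cat big_seq1 /= IH; last exact: ltnW.
by rewrite explored_face // dist_step_open.
Qed.

Lemma open_opening : opening o.
Proof.
have uni := open_unicellular.
apply/and5P; split=> //.
- apply/and4P; split.
  + by apply/forallP => h; rewrite !permE /= kept_funK.
  + apply/forallP => h; rewrite einv_open; case: ifP => _; last by rewrite eqxx.
    rewrite (geodesic_out_einv rooted_m bicolorable_m); apply/implyP => _.
    by case: (h \in outm).
  + exact: unicellular_connected.
  (* The root dart comes first in the contour and is at distance 0, so it is oriented outwards and
     its edge is cut. *)
  + rewrite bud_open /kept.
    have -> : ix (rootd o) = 0 by rewrite -(contour_open) idx_root.
    have r0 : dist (rootd o) = 0 by apply/eqP; rewrite face_dist_eq0.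
    have ro : rootd o \in outm.
      by apply: contraT => /(face_dist_notin bicolorable_m); rewrite r0.
    by rewrite ro /= andbF.
- apply/andP; split; last by apply/forallP => h; rewrite label_open.
  have -> : leaves o = cut_visited false.
    by apply/setP => h; rewrite leaf_open in_cut_visited visited_all; case: (_ \in outm).
  have -> : buds o = cut_visited true.
    by apply/setP => h; rewrite bud_open in_cut_visited visited_all; case: (_ \in outm).
  by rewrite card_cut_visited.
- apply/andP; split; apply/forallP => h; rewrite !label_open.
    apply/implyP => int; rewrite dist_face_open.
    by move: int; rewrite einv_open; case: ifP => //; rewrite eqxx.
  rewrite [vrot o]/(vrot m) face_dist_vrot.
  have [ho|ho] := boolP (h \in outm); first by rewrite face_dist_out // -addn1 PoszD.
  by rewrite [X in (Posz X) == _](face_dist_notin bicolorable_m ho) -addn1 PoszD.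
- apply/forallP => h; rewrite contour_open einv_open.
  case E: (kept h); last by rewrite eqxx.
  apply/implyP => /andP[_ lt]; move: E; rewrite /kept [_ < ix h]ltnNge (ltnW lt).
  by rewrite [_ \notin out o]/(_ \notin outm); case: (h \in outm); rewrite ?andbF.
Qed.

(* Sending a bud b to the bud matched with einv m b permutes the buds and never
   goes back along the contour, hence it is the identity. *)
Lemma closed_einv_open : closed_einv o = einv m.
Proof.
have Oo := open_opening; set mu := closed_einv o.
have eb b : b \in buds o -> einv m b \in leaves o.
  by rewrite bud_open leaf_open kept_einv (geodesic_out_einv rooted_m bicolorable_m) negbK.
have el l : l \in leaves o -> einv m l \in buds o.
  by rewrite bud_open leaf_open kept_einv (geodesic_out_einv rooted_m bicolorable_m).
pose f b := mu (einv m b).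
have fb b : b \in buds o -> f b \in buds o.
  by move=> bb; apply: matched_bud (closed_leaf Oo (eb _ bb)).
have f_inj : injective f by move=> x y /perm_inj/perm_inj.
(* Otherwise [b] would lie between [f b] and its leaf [einv m b], and have a larger label than
   [f b]; but both labels are that of the leaf minus one. *)
have f_le b : b \in buds o -> index b (contour o) <= index (f b) (contour o).
  move=> bb; rewrite leqNgt; apply/negP => lt.
  have ml := closed_leaf Oo (eb _ bb).
  have := matched_between ml lt; rewrite -/mu -/(f b) => H.
  have/H : index b (contour o) <= index (einv m b) (contour o).
    move: bb; rewrite bud_open contour_open => /andP[+ bo].
    by rewrite /kept index_einv_neq ?visited_all //= bo; case: ltngtP.
  have := matched_label ml; rewrite -/mu -/(f b) label_open.
  move: bb; rewrite bud_open => /andP[_ /face_dist_out ->].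
  by rewrite -addn1 PoszD => /addIr <-; rewrite label_open ltxx.
(* The indices of the [f b] dominate those of the [b] term by term and have the same sum, so they
   are equal. *)
have fE b : b \in buds o -> f b = b.
  have [le eqE] := leqif_sum (fun b bb => leqif_eq (f_le b bb)).
  move: eqE; have <- : \sum_(b in buds o) index b (contour o) =
      \sum_(b in buds o) index (f b) (contour o).
    rewrite -[RHS](big_imset (fun b => index b (contour o))) /=; last by move=> x y _ _; apply: f_inj.
    apply: eq_bigl => x; suff -> : f @: buds o = buds o by [].
    apply/eqP; rewrite eqEcard card_imset // leqnn andbT.
    by apply/subsetP => _ /imsetP[y yb ->]; apply: fb.
  rewrite eqxx => /esym/forall_inP H /H/eqP/(idx_inj open_unicellular).
  exact: esym.
apply/permP => h; have [int|bb|ll] := dartP o h.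
- by rewrite closed_interior // einv_open; move: int; rewrite einv_open; case: ifP; rewrite ?eqxx.
- by rewrite -[in LHS](fE _ bb) /f closedK.
- by have := fE _ (el _ ll); rewrite /f rooted_map_einvK //.
Qed.

Lemma close_open : close_map o = m.
Proof. by rewrite /close_map closed_einv_open; apply: premap_reprK. Qed.

End Opening.

(** * Bijections between classes and equality of the series *)

Lemma is_O_opening g (D : finType) (o : blossoming D) :
  is_O g o = opening o && genus_is g o.
Proof.
rewrite /is_O /opening; case: (is_rooted_blossoming o) => //=.
by case: (unicellular o) => //=; rewrite andbC.
Qed.

Lemma card_fset_set_bij (T U : choiceType) (A : set T) (B : set U) (f : T -> U) :
  finite_set A -> set_bij A B f -> #|` fset_set A| = #|` fset_set B|.
Proof.
move=> finA [fAB f_inj f_surj].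
have <- : (f @` A)%classic = B.
  apply/seteqP; split; first by move=> _ [x Ax <-]; apply: fAB.
  by move=> y /f_surj.
rewrite fset_set_image // card_in_imfset //= => x y.
by rewrite !in_fset_set //; apply: f_inj.
Qed.

Section ChiBijection.
Variables (g : nat) (P : forall n, blossoming 'I_n -> Prop)
  (Q : forall n, premap 'I_n -> Prop).
Hypothesis P_O : forall n (o : blossoming 'I_n), P o -> is_O g o.
Hypothesis Q_BC : forall n (m : premap 'I_n), Q m -> is_BC g m.
Hypothesis PQ : forall n (o : blossoming 'I_n), is_O g o -> P o <-> Q (close_map o).

(** The predicates [P] and [Q] allow one argument to serve for all maps, for 4-valent maps, and for
    the maps of a given weight. *)
Lemma chi_set_bij :
  set_bij (blossoming_classes P) (map_classes Q) chi.
Proof.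
split.
- move=> _ [n [o [Po ->]]]; exists n, (close_map o).
  split; first by apply/PQ; first exact: P_O.
  rewrite /chi close_blossoming_class //.
  by have := P_O Po; rewrite is_O_opening => /andP[].
- move=> c1 c2; rewrite !in_setE => -[n1 [o1 [P1 ->]]] [n2 [o2 [P2 ->]]] E.
  have En : n1 = n2 := congr1 (@tag _ _) E.
  case: _ / En in o2 P2 E *.
  have /andP[O1 _] : opening o1 && genus_is g o1 by rewrite -is_O_opening P_O.
  have /andP[O2 _] : opening o2 && genus_is g o2 by rewrite -is_O_opening P_O.
  congr Tagged; apply: blossoming_class_close_inj => //.
  by rewrite -!close_blossoming_class //; apply: eq_from_Tagged E.
- move=> _ [n [m [Qm ->]]].
  have /and3P[rm gm bm] := Q_BC Qm.
  have Oo := open_opening rm bm; have om := close_open rm bm.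
  have isO : is_O g (open_map rm bm).
    by rewrite is_O_opening Oo -genus_close // om.
  exists (Tagged (fun n => {set blossoming 'I_n}) (blossoming_class (open_map rm bm))).
    by exists n, (open_map rm bm); split=> //; apply/(PQ isO); rewrite om.
  by rewrite /chi close_blossoming_class // om.
Qed.

End ChiBijection.

Lemma set_bij_finset (T U : finType) (A : {set T}) (B : {set U}) (f : T -> U) :
  {in A &, injective f} -> f @: A = B ->
  set_bij [set` A]%classic [set` B]%classic f.
Proof.
move=> f_inj <-; split.
- by move=> x /= xA; apply: imset_f.
- by move=> x y; rewrite !in_setE => /= xA yA; apply: f_inj.
- by move=> _ /imsetP[x xA ->]; exists x.
Qed.

Theorem theorem3p9 (g : nat) :
  [/\ set_bij (calO g) (calBC g) chi,
      forall (n : nat) (o : blossoming 'I_n), is_O g o ->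
        forall d : nat, degree_count d (close_map o) = degree_count d o,
      set_bij (calO4 g) (calBC4 g) chi,
      forall (n : nat) (o : blossoming 'I_n), is_O g o ->
        set_bij [set` white_leaves o]%classic
                [set` white_faces (close_map o)]%classic
                (face (close_map o)) /\
        set_bij [set` black_leaves o]%classic
                [set` black_faces (close_map o) :\ face (close_map o) (rootd o)]%classic
                (face (close_map o))
    & O_series g = BC_series g /\ O4_series g = BC4_series g].
Proof.
have O_BC n (o : blossoming 'I_n) : is_O g o -> is_BC g (close_map o).
  by rewrite is_O_opening => /andP[Oo go]; apply: is_BC_close.
have weight n (o : blossoming 'I_n) : is_O g o -> blossoming_weight o = map_weight (close_map o).
  by rewrite is_O_opening => /andP[Oo _]; apply: blossoming_weight_close.
split.
- by apply: (@chi_set_bij g) => // n o Oo; split=> // _; apply: O_BC.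
(* The closure keeps [vrot], hence the vertices, so the two sides are convertible. *)
- by [].
- apply: (@chi_set_bij g) => [n o /andP[]|n m /andP[]|n o Oo] //.
  by rewrite Oo (O_BC _ _ Oo).
- move=> n o; rewrite is_O_opening => /andP[Oo _]; split; apply: set_bij_finset.
  + by move=> x y /setDP[lx _] /setDP[ly _]; apply: face_close_inj.
  + exact: face_image_white_leaves.
  + by move=> x y /setIdP[lx _] /setIdP[ly _]; apply: face_close_inj.
  + exact: face_image_black_leaves.
(* Coefficient by coefficient, [chi] restricts to a bijection between finite sets because the
   closure preserves weights. *)
- split; apply/funext => x; apply: (card_fset_set_bij (f := chi)).
  + exact: finite_O_coef.
  + apply: (@chi_set_bij g) => [n o []|n m []|n o Oo] //.
    by rewrite weight //; split=> -[_ ->]; split=> //; apply: O_BC.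
  + exact: finite_O4_coef.
  + apply: (@chi_set_bij g) => [n o [/andP[]]|n m [/andP[]]|n o Oo] //.
    have [E1 E2] : #|black_leaves o|.+1 = #|black_faces (close_map o)| /\
        #|white_leaves o| = #|white_faces (close_map o)|.
      by case: (weight _ _ Oo) => _ -> ->.
    by rewrite E1 E2 Oo (O_BC _ _ Oo).
Qed.
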